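(* Let $P,Q\in\mathbb{C}[x,y]$ and let $\xi=P\frac{\partial}{\partial x}+Q\frac{\partial}{\partial y}$. Then $\xi$ has constructible orbits in $\mathbb{C}^2$.
   Context: For a polynomial vector field $\xi$ on $\mathbb{C}^n$, $\operatorname{Sing}\xi$ is the common zero set of its coefficients. For $p\in\mathbb{C}^n$ the orbit $\mathcal{O}_p$ is the leaf through $p$ of the singular complex holomorphic foliation defined by $\xi$: if $p\in\operatorname{Sing}\xi$ then $\mathcal{O}_p=\{p\}$, and otherwise $\mathcal{O}_p$ is the leaf through $p$ of the foliation of $\mathbb{C}^n\setminus\operatorname{Sing}\xi$ by complex integral curves of $\xi$. $\overline{\mathcal{O}}_p$ denotes the Zariski closure of $\mathcal{O}_p$. For $\xi$ and a $\xi$-invariant variety $V$ (a union of orbits) defined over an algebraically closed field $\mathbb{K}\subset\mathbb{C}$ (here $\mathbb{K}=\mathbb{C}$), $\xi$ has constructible orbits in $V$ if the relation $E=\{(p,q)\in V\times V: q\in\overline{\mathcal{O}}_p\}$ is constructible over $\mathbb{K}$. *)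

(* Defs.v *)
From mathcomp Require Import all_boot all_order all_algebra.
From mathcomp Require Import all_classical all_reals all_analysis.
From mathcomp Require mpoly.
From Stdlib Require Import Relation_Operators.

Set Implicit Arguments.
Unset Strict Implicit.
Unset Printing Implicit Defensive.

Import Order.TTheory GRing.Theory Num.Theory.
Import numFieldNormedType.Exports.

Local Open Scope classical_set_scope.
Local Open Scope ring_scope.

Definition pt_eval (K : fieldType) (n : nat) (f : mpoly.mpoly n K)
    (p : 'rV[K]_n) : K :=
  mpoly.meval (fun i => p ord0 i) f.

Definition zero_locus (K : fieldType) (n : nat) (I : set (mpoly.mpoly n K)) :
    set 'rV[K]_n :=
  [set p | forall f, I f -> pt_eval f p = 0].

Definition zariski_closed (K : fieldType) (n : nat) (A : set 'rV[K]_n) : Prop :=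
  exists I : set (mpoly.mpoly n K), A = zero_locus I.

Definition zariski_closure (K : fieldType) (n : nat) (A : set 'rV[K]_n) :
    set 'rV[K]_n :=
  smallest (@zariski_closed K n) A.

Inductive constructible (K : fieldType) (n : nat) : set 'rV[K]_n -> Prop :=
| constructible_closed A : zariski_closed A -> constructible A
| constructibleC A : constructible A -> constructible (~` A)
| constructibleI A B :
    constructible A -> constructible B -> constructible (A `&` B).

(* The tuple xi stands for the vector field \sum_i xi_i d/dx_i on K^n. *)
Definition Sing (K : fieldType) (n : nat) (xi : n.-tuple (mpoly.mpoly n K)) :
    set 'rV[K]_n :=
  [set p | forall i, pt_eval (tnth xi i) p = 0].

(* [is_derive] is taken over the scalar field K: for K = R[i] it is the complex
   derivative, so that an integral curve is holomorphic on D. *)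
Definition integral_curve (K : numFieldType) (n : nat)
    (xi : n.-tuple (mpoly.mpoly n K)) (D : set K) (gamma : K -> 'rV[K]_n) :
    Prop :=
  forall t, D t ->
  forall i, is_derive t 1 (fun s => gamma s ord0 i)
                      (pt_eval (tnth xi i) (gamma t)).

Definition same_plaque (K : numFieldType) (n : nat)
    (xi : n.-tuple (mpoly.mpoly n K)) (p q : 'rV[K]_n) : Prop :=
  exists (c r : K) (gamma : K -> 'rV[K]_n),
    [/\ integral_curve xi (ball c r) gamma,
        gamma @` ball c r `<=` ~` Sing xi,
        (gamma @` ball c r) p & (gamma @` ball c r) q].

(* Off Sing xi, leaves are the classes of the equivalence relation generated by
   lying on a common plaque, i.e. points are joined by finite chains of integral
   discs; a single disc does not suffice in general. *)
Definition foliation_orbit (K : numFieldType) (n : nat)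
    (xi : n.-tuple (mpoly.mpoly n K)) (p : 'rV[K]_n) : set 'rV[K]_n :=
  [set q | (Sing xi p /\ q = p) \/
           (~ Sing xi p /\ clos_refl_sym_trans _ (same_plaque xi) p q)].

(* A pair (p, q) is encoded as the point z = row_mx p q of K^(n + n), so that
   lsubmx z = p and rsubmx z = q. *)
Definition constructible_orbits (K : numFieldType) (n : nat)
    (xi : n.-tuple (mpoly.mpoly n K)) (V : set 'rV[K]_n) : Prop :=
  constructible [set z : 'rV[K]_(n + n) |
    [/\ V (lsubmx z), V (rsubmx z)
      & zariski_closure (foliation_orbit xi (lsubmx z)) (rsubmx z)]].

(* Main.v *)
Require Import Defs.
From mathcomp Require Import all_boot all_order all_algebra.
From mathcomp Require Import all_classical all_reals all_analysis.
From mathcomp Require Import complex.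
From mathcomp Require Import ring lra zify.
From Stdlib Require Import Relation_Operators.
From mathcomp Require Import -(notations) mpoly.

(** The orbit [O_p] of a polynomial vector field [xi] on the plane is governed
    by a single algebraic object, the ideal [I_p] of the polynomials [f] all of
    whose iterated Lie derivatives [xi^k f] vanish at [p].

    - [I_p] is the ideal of [O_p] (lemma [vanishing_on_orbit]).  At a regular
      point there is an integral curve through [p], whose components are the
      power series [sum_k (xi^k x_i)(p) t^k / k!]; if [f] vanishes along it, so
      do all its derivatives, which are the [xi^k f].  Conversely the [xi^k f]
      satisfy along any integral curve a linear differential system with
      continuous coefficients, finite by the Hilbert basis theorem; so if they
      all vanish at one point of a plaque, then they vanish on the whole plaque.
      Hence [q] lies in the Zariski closure of [O_p] iff every [f] in [I_p]
      vanishes at [q].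

    - [I_p] is the kernel of the ring morphism sending [f] to its Taylor series
      along [xi] at [p], so it is prime.  At a regular point it contains no pair
      [x - a], [y - b], hence it is not maximal, hence it is principal,
      possibly zero ([orbit_ideal_principal]).

    - The degree of the generator is bounded independently of [p]
      ([generators_bounded]).  This is the theorem of Darboux and Jouanolou.  A
      nonzero generator [f_j] satisfies [xi f_j = k_j f_j] with a cofactor [k_j]
      of degree bounded by that of [xi].  With more invariant curves than the
      dimension of this space of cofactors plus one, there are two independent
      relations [sum_j u_j k_j = 0], and each yields a closed rational form
      [sum_j u_j df_j / f_j] killed by [xi].  Two such forms are proportional
      and the ratio of their components is a rational first integral [a / a'].
      Along [xi] the Taylor series of [a] and [a'] have vanishing Wronskian, so
      they are linearly dependent: every [I_p] contains a nonzero combination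
      of [a] and [a'], and this bounds all the generators at once.

    - So the closure of [O_p] is cut out by the elements of [I_p] of degree at
      most some [d].  By the Hilbert basis theorem these are the solutions of
      finitely many linear equations, whose coefficients are polynomials in
      [p].  That every solution vanishes at [q] means that the row of the
      monomials at [q] lies in the row space of the matrix of the system, a
      condition on ranks, hence on minors, hence constructible
      ([constructible_orbit_ideal_relation]). *)


Import Order.TTheory GRing.Theory Num.Theory.
Import numFieldNormedType.Exports.
Set Implicit Arguments.
Unset Strict Implicit.
Unset Printing Implicit Defensive.
Local Open Scope classical_set_scope.
Local Open Scope ring_scope.

Local Notation msize p := (@mmeasure _ _ mdeg p).
Local Notation "''X_' i" := (@mpolyX _ _ (mnm1 i)) : ring_scope.
Local Notation "''X_[' m ]" := (@mpolyX _ _ m) : ring_scope.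
Local Notation "c %:MP" := (mpolyC _ c) : ring_scope.
Local Open Scope complex_scope.
Local Notation Re := complex.Re.
Local Notation Im := complex.Im.

(** * Sequences in modules over Noetherian rings *)

Definition in_span (R : nzRingType) (V : lmodType R) (w : nat -> V) (N : nat)
    (u : V) : Prop :=
  exists c : nat -> R, u = \sum_(k < N) c k *: w k.

(** The Noetherian property of the free modules, in the form in which it is used:
    in each sequence of vectors, some term depends linearly on its
    predecessors. *)
Definition spans_stabilize (R : nzRingType) : Prop :=
  forall M (w : nat -> 'rV[R]_M), exists N, in_span w N (w N).

Section Span.
Variables (R : nzRingType) (V : lmodType R) (w : nat -> V).

Lemma in_spanD N u v : in_span w N u -> in_span w N v -> in_span w N (u + v).
Proof.
move=> [c ->] [d ->]; exists (fun k => c k + d k).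
by rewrite -big_split; apply: eq_bigr => k _; rewrite scalerDl.
Qed.

Lemma in_spanZ N a u : in_span w N u -> in_span w N (a *: u).
Proof.
move=> [c ->]; exists (fun k => a * c k).
by rewrite scaler_sumr; apply: eq_bigr => k _; rewrite scalerA.
Qed.

Lemma in_span0 N : in_span w N 0.
Proof. by exists (fun=> 0); rewrite big1 // => k _; rewrite scale0r. Qed.

Lemma in_spanB N u v : in_span w N u -> in_span w N v -> in_span w N (u - v).
Proof. by move=> hu hv; rewrite -scaleN1r; apply/in_spanD/in_spanZ. Qed.

Lemma in_span_gen N k : (k < N)%N -> in_span w N (w k).
Proof.
move=> kN; exists (fun j => (j == k)%:R).
rewrite (bigD1 (Ordinal kN)) //= eqxx scale1r big1 ?addr0 // => j.
by rewrite -val_eqE /= => /negPf ->; rewrite scale0r.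
Qed.

Lemma in_span_sum N (J : finType) (F : J -> V) :
  (forall j, in_span w N (F j)) -> in_span w N (\sum_j F j).
Proof.
move=> h; elim/big_rec: _ => [|j x _ hx]; first exact: in_span0.
exact: in_spanD.
Qed.

Lemma in_span_trans N N' u (w' : nat -> V) :
  (forall k, (k < N)%N -> in_span w' N' (w k)) -> in_span w N u ->
  in_span w' N' u.
Proof.
move=> h [c ->]; elim/big_rec: _ => [|j x _ [d ->]].
  by exists (fun=> 0); rewrite big1 // => k _; rewrite scale0r.
have [e ->] := h _ (ltn_ord j).
exists (fun k => c j * e k + d k); rewrite scaler_sumr -big_split.
by apply: eq_bigr => k _; rewrite scalerA scalerDl.
Qed.

Lemma in_spanW N N' u : (N <= N')%N -> in_span w N u -> in_span w N' u.
Proof.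
by move=> le; apply: in_span_trans => k kN; apply/in_span_gen/(leq_trans kN).
Qed.

End Span.

Lemma spans_stabilize_field (F : fieldType) : spans_stabilize F.
Proof.
move=> M w.
(* [M + 1] vectors in dimension [M] are dependent; the last term with a nonzero
   coefficient [u 0 i] depends on the previous ones. *)
pose W : 'M[F]_(M.+1, M) := \matrix_(i, j) w i 0 j.
have : kermx W != 0.
  rewrite kermx_eq0 /row_free; apply/eqP => h.
  by have := rank_leq_col W; rewrite h ltnn.
move/rowV0Pn => [u /sub_kermxP uW u0].
have [i0 ui0] : exists i, u 0 i != 0.
  apply/existsP; apply: contraNT u0; rewrite negb_exists => /forallP h.
  by apply/eqP/rowP => j; rewrite mxE; apply/eqP; move: (h j); rewrite negbK.
case: (@arg_maxnP _ i0 (fun i => u 0 i != 0) val ui0) => i ui imax.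
exists i, (fun k => - (u 0 (inord k)) / u 0 i).
apply/rowP => j; rewrite summxE.
have /matrixP/(_ 0 j) := uW; rewrite !mxE.
rewrite (eq_bigr (fun k : 'I_M.+1 => u 0 (inord k) * w k 0 j)); last first.
  by move=> k _; rewrite !mxE inord_val.
have iM : (i.+1 <= M.+1)%N by [].
rewrite (big_ord_widen_cond _ xpredT (fun k => (- u 0 (inord k) / u 0 i *: w k) 0 j) (ltnW iM)).
rewrite (bigID (fun k : 'I_M.+1 => (k < i)%N)) /=.
rewrite [X in _ + X = _](bigD1 i) ?ltnn //= inord_val.
rewrite [X in _ + (_ + X) = _]big1 ?addr0; last first.
  move=> k /andP[ki kni]; rewrite inord_val; apply/eqP; rewrite mulf_eq0.
  apply/orP; left; apply: contraNT ki => /imax /=; rewrite leq_eqVlt.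
  by move=> /predU1P[/val_inj/eqP|//]; rewrite (negPf kni).
move/eqP; rewrite addrC addr_eq0 => /eqP h.
apply: (mulfI ui); rewrite h mulr_sumr -sumrN; apply: eq_bigr => k _.
by rewrite !mxE mulrA (mulrC (u 0 i)) divfK // mulNr.
Qed.

Section HilbertBasis.
Variables (R : comNzRingType) (M : nat).
Local Notation V := 'rV[{poly R}]_M.

Let vsize (v : V) := (\max_j size (v 0%R j))%N.
Let vcoef (v : V) d : 'rV[R]_M := \row_j (v 0 j)`_d.

Let vcoef_ge v d : (vsize v <= d)%N -> vcoef v d = 0.
Proof.
move=> h; apply/rowP => j; rewrite !mxE nth_default //.
exact: leq_trans (leq_bigmax (F := fun j => size (v 0 j)) j) h.
Qed.

Let vsize_le v d : (forall e, (d <= e)%N -> vcoef v e = 0) -> (vsize v <= d)%N.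
Proof.
move=> h; apply/bigmax_leqP => j _; apply/leq_sizeP => e de.
by have /rowP/(_ j) := h _ de; rewrite !mxE.
Qed.

Lemma minimal_size_choice (U B : V -> Prop) : (exists u, U u /\ ~ B u) ->
  exists u, [/\ U u, ~ B u & forall v, U v -> ~ B v -> (vsize u <= vsize v)%N].
Proof.
move=> [u [Uu Bu]].
pose P n := `[< exists u, [/\ U u, ~ B u & vsize u = n] >].
have exP : exists n, P n by exists (vsize u); apply/asboolP; exists u.
case: (ex_minnP exP) => n /asboolP[v [Uv Bv <-]] nmin.
by exists v; split=> // z Uz Bz; apply: nmin; apply/asboolP; exists z.
Qed.

(** Hilbert's argument, with vectors of polynomials: if no finite family of
    elements of [U] generated [U], one could choose successively [f 0], [f 1],
    ... in [U], each of least degree outside the span of the previous ones.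
    The leading coefficients of some [f N] are a combination of those of the
    previous [f k], and subtracting the corresponding combination of the [f k]
    would lower the degree of [f N]. *)
Lemma submodule_fg (U : V -> Prop) : spans_stabilize R ->
  (forall u v, U u -> U v -> U (u - v)) -> (forall a u, U u -> U (a *: u)) ->
  exists (f : nat -> V) N,
    (forall k, (k < N)%N -> U (f k)) /\ forall u, U u -> in_span f N u.
Proof.
move=> stab UB UZ; apply: contrapT => nfg.
(* [nxt s] is a vector of least degree outside the span of the entries of [s]. *)
have /boolp.choice[nxt nxtP] (s : seq V) : exists u : V, (forall v, v \in s -> U v) ->
    [/\ U u, ~ in_span (nth 0 s) (size s) u & forall v, U v ->
     ~ in_span (nth 0 s) (size s) v -> (vsize u <= vsize v)%N].
  case: (pselect (forall v, v \in s -> U v)) => [sU|nsU]; last by exists 0 => /nsU.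
  have [|u hu] := @minimal_size_choice U (in_span (nth 0 s) (size s)); last first.
    by exists u.
  apply: contrapT => h; apply: nfg; exists (nth 0 s), (size s); split.
    by move=> k ks; apply/sU/mem_nth.
  by move=> u Uu; apply: contrapT => nu; apply: h; exists u.
pose s := fix s n := if n is m.+1 then rcons (s m) (nxt (s m)) else [::].
pose f n := nxt (s n).
have size_s n : size (s n) = n by elim: n => //= n IH; rewrite size_rcons IH.
have nth_s n k : (k < n)%N -> nth 0 (s n) k = f k.
  elim: n => // n IH; rewrite ltnS leq_eqVlt => /predU1P[->|kn] /=.
    by rewrite nth_rcons size_s ltnn eqxx.
  by rewrite nth_rcons size_s kn IH.
have sU n : forall v, v \in s n -> U v.
  elim: n => // n IH v /=; rewrite mem_rcons inE => /predU1P[->|/IH//].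
  by have [] := nxtP _ IH.
have span_s n u : in_span (nth 0 (s n)) (size (s n)) u <-> in_span f n u.
  rewrite size_s; split; apply: in_span_trans => k kn.
    by rewrite nth_s //; apply: in_span_gen.
  by rewrite -(nth_s n) //; apply: in_span_gen.
have fP n : [/\ U (f n), ~ in_span f n (f n) & forall v, U v ->
     ~ in_span f n v -> (vsize (f n) <= vsize v)%N].
  have [Uu nu um] := nxtP _ (@sU n); split=> //.
    by move/span_s.
  by move=> v Uv nv; apply: um => // /span_s.
have [N [c hc]] := stab M (fun k => vcoef (f k) (vsize (f k)).-1).
have [UN nN Nmin] := fP N.
have vs0 v : vsize v = 0%N -> v = 0.
  move=> h; apply/rowP => j; rewrite mxE; apply/eqP; rewrite -size_poly_eq0.
  have := leq_bigmax (F := fun j => size (v 0 j)) j.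
  by rewrite -/(vsize v) h; case: (size _).
have sz_gt n : (0 < vsize (f n))%N.
  rewrite lt0n; apply/eqP => /vs0 h; have [_ + _] := fP n; apply.
  by rewrite h; apply: in_span0.
pose d n := (vsize (f n)).-1.
have le_d k : (k < N)%N -> (d k <= d N)%N.
  move=> kN; have [_ _ kmin] := fP k; rewrite /d -!subn1 leq_sub2r //; apply: kmin => //.
  by move=> h; apply: nN; apply: in_spanW h; apply: ltnW.
(* The combination of the previous vectors with the same leading coefficients
   as [f N]; powers of the variable bring the degrees to [d N]. *)
pose g : V := \sum_(k < N) ((c k)%:P * 'X^(d N - d k)) *: f k.
have gspan : in_span f N g.
  by apply: in_span_sum => k; apply/in_spanZ/in_span_gen.
have Ug : U g.
  rewrite /g; elim/big_rec: _ => [|k x _ Ux].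
    by rewrite -(subrr (f 0)); have [h _ _] := fP 0; apply: UB.
  rewrite addrC -[X in _ + X]opprK; apply: UB => //; rewrite -scaleNr.
  by have [h _ _] := fP k; apply: UZ.
have : (vsize (f N) <= vsize (f N - g))%N.
  apply: Nmin; first exact: UB.
  by move=> h; apply: nN; rewrite -(subrK g (f N)); apply: in_spanD.
suff : (vsize (f N - g) <= d N)%N.
  move=> h1 /leq_trans/(_ h1); rewrite /d; have := sz_gt N.
  by case: (vsize (f N)) => // m _ /=; rewrite ltnn.
apply: vsize_le => e le_e.
have -> : vcoef (f N - g) e =
    vcoef (f N) e - \sum_(k < N) c k *: vcoef (f k) (e - (d N - d k)).
  apply/rowP => j; rewrite !mxE coefB summxE; congr (_ - _).
  rewrite summxE coef_sum; apply: eq_bigr => k _.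
  rewrite !mxE -mulrA coefCM coefXnM; case: ltnP => // h.
  exfalso; move: h; rewrite ltnNge => /negP; apply.
  exact: leq_trans (leq_subr _ _) le_e.
move: le_e; rewrite leq_eqVlt => /predU1P[<-|lt_e].
  rewrite [X in X - _]hc -sumrB big1 // => k _.
  by rewrite subKn ?subrr // le_d.
rewrite vcoef_ge; last by move: lt_e; rewrite /d; case: (vsize _).
rewrite big1 ?subr0 // => k _; rewrite vcoef_ge ?scaler0 //.
have := le_d k (ltn_ord k); have := sz_gt k; move: lt_e; rewrite -!/(d _).
have -> : vsize (f k) = (d k).+1 by rewrite /d prednK.
by move=> lt_e _ le; rewrite subnBA // ltn_subRL ltn_add2r.
Qed.

End HilbertBasis.

Lemma spans_stabilize_poly (R : comNzRingType) :
  spans_stabilize R -> spans_stabilize {poly R}.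
Proof.
move=> stab M w.
pose U u := exists N, in_span w N u.
have UD u v : U u -> U v -> U (u - v).
  move=> [n hu] [m hv]; exists (maxn n m); apply: in_spanB.
    by apply: in_spanW hu; apply: leq_maxl.
  by apply: in_spanW hv; apply: leq_maxr.
have UZ a u : U u -> U (a *: u) by move=> [n hu]; exists n; apply: in_spanZ.
have [f [n [fU fspan]]] := submodule_fg stab UD UZ.
have [m hm] : exists m, forall k, (k < n)%N -> in_span w m (f k).
  elim: n fU {fspan} => [|n IH] fU; first by exists 0.
  have [m hm] := IH (fun k kn => fU k (ltnW kn)).
  have [m' hm'] := fU n (ltnSn n).
  exists (maxn m m') => k; rewrite ltnS leq_eqVlt => /predU1P[->|kn].
    by apply: in_spanW hm'; apply: leq_maxr.
  by apply: in_spanW (hm _ kn); apply: leq_maxl.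
exists m; apply: (in_span_trans hm); apply: fspan.
by exists m.+1; apply: in_span_gen.
Qed.

Lemma spans_stabilize_image (R S : nzRingType) (e : {rmorphism R -> S}) :
  (forall y, exists x, e x = y) -> spans_stabilize R -> spans_stabilize S.
Proof.
move=> /boolp.choice[h eK] stab M w.
have [N [c hc]] := stab M (fun k => map_mx h (w k)).
exists N, (fun k => e (c k)); apply/rowP => j; have /rowP/(_ j) := hc.
rewrite !mxE !summxE => /(congr1 e); rewrite eK rmorph_sum => ->.
by apply: eq_bigr => k _; rewrite !mxE rmorphM eK.
Qed.

(** * Taylor coefficients along a derivation *)

Section Jets.
Variables (A : comNzRingType) (K : numFieldType) (ev : {rmorphism A -> K}).
Variable D : A -> A.
Hypothesis DD : {morph D : f g / f + g}.
Hypothesis DM : forall f g, D (f * g) = D f * g + f * D g.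

Definition jet k f := ev (iter k D f).

Let D0 : D 0 = 0.
Proof. by apply: (addrI (D 0)); rewrite -DD !addr0. Qed.

Lemma iter_derivD k f g : iter k D (f + g) = iter k D f + iter k D g.
Proof. by elim: k => //= k ->; rewrite DD. Qed.

Lemma iter_deriv0 k : iter k D 0 = 0.
Proof. by elim: k => //= k ->; rewrite D0. Qed.

Lemma iter_deriv_sum (J : Type) (r : seq J) (F : J -> A) k :
  iter k D (\sum_(j <- r) F j) = \sum_(j <- r) iter k D (F j).
Proof.
elim: r => [|j r IH]; first by rewrite !big_nil iter_deriv0.
by rewrite !big_cons iter_derivD IH.
Qed.

Lemma leibniz n f g : iter n D (f * g) =
  \sum_(k < n.+1) (iter k D f * iter (n - k) D g) *+ 'C(n, k).
Proof.
elim: n f g => [|n IH] f g.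
  by rewrite big_ord_recl big_ord0 /= mulr1n addr0.
rewrite iterSr DM iter_derivD !IH.
rewrite [X in X + _]big_ord_recr [X in _ + X]big_ord_recl [RHS]big_ord_recl.
rewrite [X in _ = _ + X]big_ord_recr /=.
rewrite /bump /= !add1n !bin0 !binn !subn0 !subSS !subnn !mulr1n -!iterSr /=.
set S1 := (X in X + _ + _); set S2 := (X in _ + (_ + X)).
set S := (X in _ = _ + (X + _)).
suff -> : S = S1 + S2 by rewrite add0n; ring.
rewrite -big_split; apply: eq_bigr => k _ /=.
rewrite add1n add0n binS mulrnDr [RHS]addrC -!iterSr subSS.
by congr (_ + _); rewrite subnSK.
Qed.

Lemma jetM_low n m N f g : (forall k, (k < n)%N -> jet k f = 0) ->
  (forall k, (k < m)%N -> jet k g = 0) -> (N < n + m)%N -> jet N (f * g) = 0.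
Proof.
move=> hf hg lt; rewrite /jet leibniz rmorph_sum big1 // => k _.
rewrite rmorphMn rmorphM; case: (ltnP k n) => kn.
  by rewrite [ev (iter k D f)]hf // mul0r mul0rn.
rewrite [ev (iter (N - k) D g)]hg ?mulr0 ?mul0rn //.
by have := ltn_ord k; lia.
Qed.

(** The leading coefficient of a product of two power series of order at least
    [n] and [m]. *)
Lemma jetM_lead n m f g : (forall k, (k < n)%N -> jet k f = 0) ->
  (forall k, (k < m)%N -> jet k g = 0) ->
  jet (n + m) (f * g) = jet n f * jet m g *+ 'C(n + m, n).
Proof.
move=> hf hg; rewrite /jet leibniz rmorph_sum.
have nm : (n < (n + m).+1)%N by rewrite ltnS leq_addr.
rewrite (bigD1 (Ordinal nm)) //= rmorphMn rmorphM addKn big1 ?addr0 // => k.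
rewrite -val_eqE /= rmorphMn rmorphM; case: ltngtP => // kn _.
  by rewrite [ev (iter k D f)]hf // mul0r mul0rn.
rewrite [ev (iter (n + m - k) D g)]hg ?mulr0 ?mul0rn //.
by have := ltn_ord k; lia.
Qed.

Lemma jet_first f : ~ (forall k, jet k f = 0) ->
  exists2 n, jet n f != 0 & forall k, (k < n)%N -> jet k f = 0.
Proof.
move=> h; have ex : exists n, jet n f != 0.
  by apply/not_existsP => h'; apply: h => k; apply/eqP/negPn/negP/h'.
case: (ex_minnP ex) => n n0 nmin; exists n => // k kn.
by apply/eqP/negPn; apply: contraTN kn => /nmin; rewrite -leqNgt.
Qed.

(** Up to factorials, [jet k f] is the [k]-th coefficient of a power series, and
    this series is multiplicative in [f].  Power series over a field of
    characteristic zero form a domain. *)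
Lemma jet_prime f g : (forall k, jet k (f * g) = 0) ->
  (forall k, jet k f = 0) \/ (forall k, jet k g = 0).
Proof.
move=> fg; apply: contrapT => /not_orP[/jet_first[n n0 hn] /jet_first[m m0 hm]].
have /eqP := jetM_lead hn hm; rewrite fg eq_sym -mulr_natr !mulf_eq0.
rewrite (negPf n0) (negPf m0) /= pnatr_eq0 -leqn0 leqNgt bin_gt0 leq_addr.
by [].
Qed.

Lemma jet_mull f g : (forall k, jet k f = 0) -> forall k, jet k (g * f) = 0.
Proof.
move=> hf k; apply: (@jetM_low 0 k.+1) => // j _; exact: hf.
Qed.

Lemma jetZ a f (c : K) : (forall g, ev (a * g) = c * ev g) -> D a = 0 ->
  forall k, jet k (a * f) = c * jet k f.
Proof.
move=> ha Da k; rewrite /jet; suff -> : iter k D (a * f) = a * iter k D f by [].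
by elim: k => //= k ->; rewrite DM Da mul0r add0r.
Qed.

(** Two power series with vanishing Wronskian are proportional.  If [a] has order
    [n], some combination [u] of [a] and [b] has no term of degree [n]; the
    Wronskian of [a] and [u] still vanishes, and its leading term shows that [a]
    and [u] would have the same order if [u] were nonzero. *)
Lemma wronskian_dependent (cst : K -> A) a b :
  (forall c, D (cst c) = 0) -> (forall c, ev (cst c) = c) ->
  D a * b = a * D b ->
  exists c d : K, (c != 0) || (d != 0) /\
    forall k, jet k (cst c * a + cst d * b) = 0.
Proof.
move=> Dc ec W.
have jc c f k : jet k (cst c * f) = c * jet k f.
  by apply: jetZ => // g; rewrite rmorphM ec.
have c1 f k : jet k (cst 1 * f) = jet k f by rewrite jc mul1r.
have jD f g k : jet k (f + g) = jet k f + jet k g.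
  by rewrite /jet iter_derivD rmorphD.
case: (pselect (forall k, jet k a = 0)) => [ha|/jet_first[n n0 hn]].
  exists 1, 0; rewrite oner_eq0; split=> // k.
  by rewrite jD !jc ha mulr0 mul0r addr0.
exists (jet n b), (- jet n a); rewrite oppr_eq0 n0 orbT; split=> //.
set u := _ + _.
have Wu : D a * u = a * D u.
  have Du : D u = cst (jet n b) * D a + cst (- jet n a) * D b.
    by rewrite DD !DM !Dc !mul0r !add0r.
  rewrite Du /u !mulrDr; congr (_ + _); first by ring.
  by rewrite mulrCA W; ring.
have un : jet n u = 0 by rewrite jD !jc mulNr mulrC subrr.
apply: contrapT => /jet_first[l l0 hl].
have nl : n != l by apply: contra_neq l0 => <-.
have hDa m : (forall k, (k < m)%N -> jet k a = 0) ->
    forall k, (k < m.-1)%N -> jet k (D a) = 0.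
  by move=> h k km; rewrite /jet -iterSr; apply: h; lia.
have hDu m : (forall k, (k < m)%N -> jet k u = 0) ->
    forall k, (k < m.-1)%N -> jet k (D u) = 0.
  by move=> h k km; rewrite /jet -iterSr; apply: h; lia.
have jS f k : jet k (D f) = jet k.+1 f by rewrite /jet -iterSr.
clearbody u.
case: n l => [|n] [|l] // in n0 hn un l0 hl nl *.
- have := congr1 (jet l) Wu; rewrite (@jetM_low 0 l.+1) //.
  move: (@jetM_lead 0 l a (D u)); rewrite add0n bin0 mulr1n => -> //; last exact: (hDu l.+1).
  by move/eqP; rewrite eq_sym mulf_eq0 (negPf n0) jS (negPf l0).
- have := congr1 (jet n) Wu; rewrite (@jetM_low n.+1 0 n a) ?addn0 //.
  move: (@jetM_lead n 0 (D a) u); rewrite addn0 binn mulr1n => -> //; last exact: (hDa n.+1).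
  by move/eqP; rewrite mulf_eq0 (negPf l0) jS (negPf n0).
(* Both orders are positive: compare the coefficients of degree one less than
   their sum. *)
have := congr1 (jet (n + l.+1)) Wu.
rewrite (@jetM_lead n l.+1) //; last exact: (hDa n.+1).
have e1 : (n + l.+1 = n.+1 + l)%N by lia.
rewrite e1 (@jetM_lead n.+1 l) //; last exact: (hDu l.+1).
rewrite !jS -[LHS]mulr_natr -[RHS]mulr_natr => /eqP.
rewrite -subr_eq0 -mulrBr !mulf_eq0 (negPf n0) (negPf l0) /= subr_eq0.
rewrite eqr_nat => /eqP e.
have := mul_bin_left (n.+1 + l) n.
have -> : (n.+1 + l - n = l.+1)%N by lia.
move/eqP; rewrite -e eqn_pmul2r; last by rewrite bin_gt0; lia.
by rewrite (negPf nl).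
Qed.

End Jets.

(** * Nonmaximal prime ideals of the plane are principal *)

Section PrimeIdealsOfThePlane.
Variable F : closedFieldType.
Local Notation B := {poly {poly F}}.
Local Notation linx a := (('X - a%:P)%:P : B).
Local Notation liny b := ('X - b%:P%:P : B).

Let evx (a : F) : {rmorphism B -> {poly F}} := map_poly (horner_eval a).

Let evxE a h i : (evx a h)`_i = (h`_i).[a].
Proof. by rewrite coef_map. Qed.

(** [evx a] sets [x = a]; this is the factor theorem in each coefficient. *)
Lemma linx_dvd a (h : B) : evx a h = 0 -> exists q, h = q * linx a.
Proof.
move=> /polyP h0; exists (\poly_(i < size h) (h`_i %/ ('X - a%:P))).
apply/polyP => i; rewrite coefMC coef_poly; case: ltnP => hi; last first.
  by rewrite mul0r nth_default.
have := h0 i; rewrite coef_map coef0 /= /horner_eval => /eqP/factor_theorem[q ->].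
by rewrite mulpK // polyXsubC_eq0.
Qed.

Lemma linx_neq0 a : linx a != 0 :> B.
Proof. by rewrite polyC_eq0 polyXsubC_eq0. Qed.

Lemma size_linxM (f : B) a : f != 0 ->
  size (f * linx a) = size f /\
  lead_coef (f * linx a) = lead_coef f * ('X - a%:P).
Proof.
move=> f0; rewrite mulrC mul_polyC lead_coefZ mulrC; split=> //.
by rewrite size_scale // polyXsubC_eq0.
Qed.

(** Over an algebraically closed field [c] splits into linear factors [x - a].
    Each of them is prime and does not divide [f], so it divides the cofactor
    [q] and can be cancelled. *)
Lemma strip_content (f : B) :
  (forall a f', f <> f' * linx a) ->
  forall (c : {poly F}) (h q : B), c != 0 -> c%:P * h = q * f ->
  exists g, h = g * f.
Proof.
move=> nf c h q; have [n] := ubnP (size c).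
elim: n c h q => // n IH c h q sc c0 e.
case: (boolP (size c == 1)%N) => [/size_poly1P[k k0 ck]|sc1].
  exists ((k^-1)%:P%:P * q); rewrite -mulrA -e ck mulrA -!polyCM mulVf //.
  by rewrite mul1r.
have [a /factor_theorem[c' ec]] := closed_rootP c sc1.
have : evx a (q * f) = 0.
  rewrite -e rmorphM /= ec; apply/eqP; rewrite mulf_eq0; apply/orP; left.
  rewrite [map_poly _ _]map_polyC /= polyC_eq0 /horner_eval.
  by rewrite hornerM hornerXsubC subrr mulr0.
rewrite rmorphM => /eqP; rewrite mulf_eq0 => /orP[] /eqP /linx_dvd[r er]; last first.
  by case: (nf a r).
apply: (IH c' h r).
- rewrite ec size_Mmonic ?monicXsubC // ?size_XsubC ?addn2 // in sc.
  by apply: contraNneq c0 => c'0; rewrite ec c'0 mul0r.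
- by apply: contraNneq c0 => c'0; rewrite ec c'0 mul0r.
apply: (mulIf (linx_neq0 a)); rewrite mulrAC [RHS]mulrAC -er -e; congr (_ * _).
by rewrite -polyCM -ec.
Qed.

Variable I : B -> Prop.
Hypothesis I0 : I 0.
Hypothesis IB : forall f g, I f -> I g -> I (f - g).
Hypothesis IM : forall f g, I f -> I (g * f).
Hypothesis Ip : forall f g, I (f * g) -> I f \/ I g.
Hypothesis I1 : ~ I 1.

Let I_const c : I c%:P%:P -> c = 0.
Proof.
move=> h; apply/eqP/negPn/negP => c0; apply: I1.
have -> : 1 = (c^-1)%:P%:P * c%:P%:P :> B by rewrite -!polyCM mulVf.
exact: IM.
Qed.

Let I_univariate (p : {poly F}) : (forall b, ~ I (liny b)) ->
  I (map_poly polyC p) -> p = 0.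
Proof.
move=> nI; have [r ->] := closed_field_poly_normal p.
suff nP : ~ I (map_poly polyC (\prod_(z <- r) ('X - z%:P))).
  by rewrite map_polyZ /= -mul_polyC => /Ip[/I_const->|/nP//]; rewrite scale0r.
rewrite rmorph_prod; elim: r => [|b r IH]; first by rewrite big_nil.
rewrite big_cons => /Ip[|/IH//].
by rewrite rmorphB /= map_polyX map_polyC => /nI.
Qed.

(** If some [x - a] is in [I], it generates [I]: modulo [x - a] a polynomial
    depends on [y] alone and splits into factors [y - b], none of which is in
    [I].  Otherwise let [f] be a nonzero element of [I] of least degree in [y],
    with leading coefficient of least degree in [x].  Pseudo-division of [h] in
    [I] by [f] has remainder zero, and [f] has no factor [x - a] by the second
    minimality, so that [strip_content] removes the power of the leading
    coefficient. *)
Lemma prime_principal : (forall a b, ~ (I (linx a) /\ I (liny b))) ->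
  exists f, forall h, I h <-> exists g, h = g * f.
Proof.
move=> nmax.
case: (pselect (exists a, I (linx a))) => [[a Ia]|nIx].
  exists (linx a) => h; split=> [Ih|[g ->]]; last exact: IM.
  pose h0 : B := map_poly polyC (evx a h).
  have [q eq] : exists q, h - h0 = q * linx a.
    apply: linx_dvd; rewrite rmorphB; apply/polyP => i.
    rewrite coefB coef0 !evxE coef_map_id0 // evxE.
    by rewrite hornerC subrr.
  suff h00 : h0 = 0 by exists q; rewrite -eq h00 subr0.
  rewrite /h0 (I_univariate (p := evx a h)) ?rmorph0 //.
    by move=> b Ib; apply: (nmax a b).
  have -> : map_poly polyC (evx a h) = h - (h - h0) by rewrite subKr.
  by rewrite eq; apply: IB => //; apply: IM.
case: (pselect (exists2 f, I f & f != 0)) => [[f1 If1 f10]|nI]; last first.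
  exists 0 => h; split=> [Ih|[g ->]]; last by rewrite mulr0.
  exists 0; rewrite mulr0; apply/eqP/negPn/negP => h0; apply: nI.
  by exists h.
pose good n := `[< exists f, [/\ I f, f != 0 & size f = n] >].
have exg : exists n, good n by exists (size f1); apply/asboolP; exists f1.
case: (ex_minnP exg) => n /asboolP[f2 [If2 f20 sf2]] nmin.
pose good2 m := `[< exists f, [/\ I f, f != 0, size f = n & size (lead_coef f) = m] >].
have exg2 : exists m, good2 m.
  by exists (size (lead_coef f2)); apply/asboolP; exists f2.
case: (ex_minnP exg2) => m /asboolP[f [If f0 sf sl]] mmin.
exists f => h; split=> [Ih|[g ->]]; last exact: IM.
have e := Pdiv.Idomain.divp_eq h f.
apply: (@strip_content f _ (lead_coef f ^+ scalp h f) h (h %/ f)).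
- move=> a f' ef.
  have f'0 : f' != 0 by apply: contraNneq f0 => f'0; rewrite ef f'0 mul0r.
  have [s1 l1] := size_linxM a f'0.
  have If' : I f'.
    by move: If; rewrite ef => /Ip[//|Ia]; case: nIx; exists a.
  have : (m <= size (lead_coef f'))%N.
    by apply: mmin; apply/asboolP; exists f'; split=> //; rewrite -sf ef s1.
  rewrite -sl ef l1 size_Mmonic ?monicXsubC ?lead_coef_eq0 //.
  by rewrite size_XsubC addn2 /= ltnn.
- by rewrite expf_neq0 // lead_coef_eq0.
have r0 : h %% f = 0.
  apply/eqP/negPn/negP => r0.
  have : (n <= size (h %% f)%R)%N.
    apply: nmin; apply/asboolP; exists (h %% f); split=> //.
    have -> : h %% f = lead_coef f ^+ scalp h f *: h - h %/ f * f.
      by rewrite e addrC addKr.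
    by apply: IB; [rewrite -mul_polyC; apply: IM|apply: IM].
  by rewrite -sf leqNgt Pdiv.Idomain.ltn_modp f0.
by rewrite mul_polyC e r0 addr0.
Qed.

End PrimeIdealsOfThePlane.

(** * Lie derivatives and the ideal of an orbit *)

Section LieDerivative.
Variables (K : numFieldType) (n : nat) (xi : n.-tuple (mpoly n K)).
Implicit Types (f g : mpoly n K) (p : 'rV[K]_n).

Definition lie f : mpoly n K := \sum_i tnth xi i * mderiv i f.

Lemma lieD : {morph lie : f g / f + g}.
Proof.
move=> f g; rewrite -big_split; apply: eq_bigr => i _ /=.
by rewrite mderivD mulrDr.
Qed.

Lemma lieM f g : lie (f * g) = lie f * g + f * lie g.
Proof.
rewrite mulr_suml mulr_sumr -big_split; apply: eq_bigr => i _ /=.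
by rewrite mderivM; ring.
Qed.

Lemma lieC c : lie c%:MP = 0.
Proof. by apply: big1 => i _; rewrite mderivC mulr0. Qed.

Lemma lieX i : lie 'X_i = tnth xi i.
Proof.
rewrite /lie (bigD1 i) //= big1 => [|j ji]; rewrite mderivX mnm1E.
  have -> : mnm_sub (mnm1 i) (mnm1 i) = mnm0.
    by apply/mnmP => j; rewrite mnmBE subnn mnm0E.
  by rewrite eqxx scale1r mpolyX0 mulr1 addr0.
by rewrite eq_sym (negPf ji) scale0r mulr0.
Qed.

(** The polynomials whose Taylor series along [xi] at [p] is zero. *)
Definition orbit_ideal p f := forall k, pt_eval (iter k lie f) p = 0.

Lemma orbit_idealP p f :
  orbit_ideal p f <-> forall k, jet (meval (fun i => p ord0 i)) lie k f = 0.
Proof. by []. Qed.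

Lemma orbit_ideal_eval p f : orbit_ideal p f -> pt_eval f p = 0.
Proof. by move/(_ 0%N). Qed.

Lemma orbit_ideal_lie p f : orbit_ideal p f -> orbit_ideal p (lie f).
Proof. by move=> h k; rewrite -iterSr; apply: h. Qed.

Lemma orbit_ideal0 p : orbit_ideal p 0.
Proof. by move=> k; rewrite (iter_deriv0 lieD) [pt_eval _ _]meval0. Qed.

Lemma orbit_idealD p f g :
  orbit_ideal p f -> orbit_ideal p g -> orbit_ideal p (f + g).
Proof.
move=> hf hg k; rewrite (iter_derivD lieD) [pt_eval _ _]mevalD.
by rewrite [X in X + _]hf [X in _ + X]hg addr0.
Qed.

Lemma orbit_idealM p f g : orbit_ideal p f -> orbit_ideal p (g * f).
Proof.
by move=> hf; apply/orbit_idealP/(jet_mull lieD lieM).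
Qed.

Lemma orbit_idealB p f g :
  orbit_ideal p f -> orbit_ideal p g -> orbit_ideal p (f - g).
Proof.
by move=> hf hg; rewrite -mulN1r; apply/orbit_idealD/orbit_idealM.
Qed.

Lemma orbit_ideal_prime p f g :
  orbit_ideal p (f * g) -> orbit_ideal p f \/ orbit_ideal p g.
Proof. by move/orbit_idealP/(jet_prime lieD lieM). Qed.

Lemma orbit_ideal1 p : ~ orbit_ideal p 1.
Proof.
by move/orbit_ideal_eval; rewrite [pt_eval _ _]meval1 => /eqP; rewrite oner_eq0.
Qed.

Lemma orbit_idealC p c : orbit_ideal p c%:MP -> c = 0.
Proof. by move/orbit_ideal_eval; rewrite [pt_eval _ _]mevalC. Qed.

Lemma orbit_ideal_sum p (J : finType) (P : pred J) (F : J -> mpoly n K) :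
  (forall j, P j -> orbit_ideal p (F j)) -> orbit_ideal p (\sum_(j | P j) F j).
Proof.
move=> h; elim/big_rec: _ => [|j x Pj hx]; first exact: orbit_ideal0.
by apply: orbit_idealD => //; apply: h.
Qed.

Lemma orbit_ideal_prod p (J : finType) (P : pred J) (F : J -> mpoly n K) :
  orbit_ideal p (\prod_(j | P j) F j) -> exists2 j, P j & orbit_ideal p (F j).
Proof.
elim/big_rec: _ => [/orbit_ideal1//|j x Pj IH /orbit_ideal_prime[|/IH//]].
by move=> h; exists j.
Qed.

(** The Lie derivative of the coordinate [x_i - c] is the [i]-th coefficient of
    the field, so that at a regular point not all coordinates are constant. *)
Lemma orbit_ideal_linear p i (c : K) :
  orbit_ideal p ('X_i - c%:MP) -> pt_eval (tnth xi i) p = 0.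
Proof.
move/orbit_ideal_lie/orbit_ideal_eval.
have -> : lie ('X_i - c%:MP) = tnth xi i by rewrite -mpolyCN lieD lieX lieC addr0.
by [].
Qed.

(** Every Lie derivative vanishes at a singular point, so that there the orbit
    ideal is the maximal ideal of the point. *)
Lemma orbit_ideal_Sing p f : Sing xi p -> pt_eval f p = 0 -> orbit_ideal p f.
Proof.
move=> sp f0 [|k] //; rewrite iterS [pt_eval _ _]rmorph_sum big1 // => i _.
by rewrite /= mevalM [X in X * _](sp i) mul0r.
Qed.

End LieDerivative.

Section PlaneRing.
Variable F : fieldType.
Let x0 : mpoly 2 F := 'X_ord0.
Let y0 : mpoly 2 F := 'X_ord_max.

Let comx : commr_rmorph (@mpolyC 2 F) x0. Proof. by move=> c; apply: mulrC. Qed.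
Let inner : {rmorphism {poly F} -> mpoly 2 F} := horner_morph comx.
Let comy : commr_rmorph inner y0. Proof. by move=> c; apply: mulrC. Qed.
Let e : {rmorphism {poly {poly F}} -> mpoly 2 F} := horner_morph comy.

(** Transports statements about iterated univariate polynomials, to which
    Euclidean division and the Hilbert basis theorem apply, to [mpoly 2 F]. *)
Lemma plane_ring_surjection : exists e : {rmorphism {poly {poly F}} -> mpoly 2 F},
  [/\ forall f, exists b, e b = f, forall c, e (c%:P%:P) = c%:MP,
      e 'X%:P = 'X_ord0 & e 'X = 'X_ord_max].
Proof.
exists e.
have eC c : e (c%:P%:P) = c%:MP.
  by rewrite /e /= horner_morphC /inner /= horner_morphC.
have eX : e 'X%:P = 'X_ord0.
  by rewrite /e /= horner_morphC /inner /= horner_morphX.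
have eY : e 'X = 'X_ord_max by rewrite /e /= horner_morphX.
split=> //; elim/mpolyind => [|c m f _ _ [b <-]]; first by exists 0; rewrite rmorph0.
have [bm <-] : exists b, e b = 'X_[m].
  exists ('X%:P ^+ m ord0 * 'X ^+ m ord_max).
  rewrite rmorphM !rmorphXn mpolyXE_id big_ord_recl big_ord1 /= eX eY.
  by congr (_ * 'X_ _ ^+ m _); apply: val_inj.
by exists (c%:P%:P * bm + b); rewrite rmorphD rmorphM eC mul_mpolyC.
Qed.

Lemma spans_stabilize_plane : spans_stabilize (mpoly 2 F).
Proof.
have [e' [sur _ _ _]] := plane_ring_surjection.
by apply: (spans_stabilize_image (e := e')) => //; do 2!apply: spans_stabilize_poly; apply: spans_stabilize_field.
Qed.

End PlaneRing.

(** The two linear forms [x - a] and [y - b] are not both in the orbit ideal of a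
    regular point, as both coefficients of the field would vanish there. *)
Lemma orbit_ideal_principal (K : numClosedFieldType)
    (xi : 2.-tuple (mpoly 2 K)) (p : 'rV[K]_2) :
  ~ Sing xi p ->
  exists f, forall h, orbit_ideal xi p h <-> exists g, h = g * f.
Proof.
move=> nS; have [e [sur eC eX eY]] := plane_ring_surjection K.
pose I b := orbit_ideal xi p (e b).
have [||||||b hb] := @prime_principal K I.
- by rewrite /I rmorph0; apply: orbit_ideal0.
- by move=> f g; rewrite /I rmorphB; apply: orbit_idealB.
- by move=> f g; rewrite /I rmorphM; apply: orbit_idealM.
- by move=> f g; rewrite /I rmorphM; apply: orbit_ideal_prime.
- by rewrite /I rmorph1; apply: orbit_ideal1.
- move=> a b; rewrite /I polyCB !rmorphB eX eY !eC.
  move=> [/orbit_ideal_linear h0 /orbit_ideal_linear h1]; apply: nS => i.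
  have [->|->] // : i = ord0 \/ i = ord_max.
  by case: i => [[|[|]]] // ?; [left|right]; apply: val_inj.
exists (e b) => h; split=> [|[g ->]].
  have [h' <-] := sur h => /hb[g ->].
  by exists (e g); rewrite rmorphM.
by apply: orbit_idealM; apply/hb; exists 1; rewrite mul1r.
Qed.

(** * Invariant curves and first integrals *)

Lemma msize_mderiv n (K : nzRingType) i (f : mpoly n K) :
  (msize (mderiv i f) <= (msize f).-1)%N.
Proof.
rewrite [X in (X <= _)%N]msizeE; apply/bigmax_leqP_seq => m mf _.
have : mnm_add m (mnm1 i) \in msupp f.
  move: mf; rewrite !mcoeff_msupp mcoeff_deriv.
  by apply: contraNN => /eqP ->; rewrite mul0rn.
by move=> /msize_mdeg_lt; rewrite mdegD mdeg1 addn1; case: (msize f).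
Qed.

Lemma mderiv_eq0_const n (K : numDomainType) (f : mpoly n K) :
  (forall i, mderiv i f = 0) -> f = (mcoeff mnm0 f)%:MP.
Proof.
move=> h; apply/mpolyP => m; rewrite mcoeffC.
have [->|m0] := eqVneq m mnm0; first by rewrite mulr1.
rewrite mulr0.
have [i mi] : exists i, m i != 0%N.
  apply/existsP; apply: contraNT m0; rewrite negb_exists => /forallP h0.
  by apply/eqP/mnmP => i; rewrite mnm0E; apply/eqP/negPn/h0.
have := mcoeff_deriv i (mnm_sub m (mnm1 i)) f.
rewrite submK ?lep1mP // h mcoeff0 => /esym/eqP.
by rewrite mulrn_eq0 /= => /eqP.
Qed.

(** Let [w = (a dx + b dy) / F] and [w' = (a' dx + b' dy) / F] be closed forms
    killed by the field [P X + Q Y].  They are proportional, [w = H w'], and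
    closedness gives [dH] proportional to [w'], which the field kills; so
    [H = a / a'] is a first integral.  The conclusion is this statement cleared
    of denominators. *)
Lemma first_integral (A : idomainType) (X Y : A -> A) (P Q a b a' b' F : A) :
  {morph X : f g / f + g} -> (forall f g, X (f * g) = X f * g + f * X g) ->
  Q != 0 -> F != 0 ->
  P * a + Q * b = 0 -> P * a' + Q * b' = 0 ->
  Y a * F - a * Y F = X b * F - b * X F ->
  Y a' * F - a' * Y F = X b' * F - b' * X F ->
  (P * X a + Q * Y a) * a' = a * (P * X a' + Q * Y a').
Proof.
move=> XD XM Q0 F0 e e' c c'.
have X0 : X 0 = 0 by apply: (addrI (X 0)); rewrite -XD !addr0.
have E : a * b' - a' * b = 0.
  apply: (mulfI Q0); rewrite mulr0.
  transitivity (a * (P * a' + Q * b') - a' * (P * a + Q * b)); first by ring.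
  by rewrite e e' !mulr0 subrr.
have := congr1 X e; have := congr1 X e'; rewrite !XD !XM X0 => Xe' Xe.
apply/eqP; rewrite -subr_eq0; apply/eqP/(mulfI F0); rewrite mulr0.
(* A combination of the two closedness relations, of the [X]-derivatives of the
   two vanishing conditions and of the proportionality [E]. *)
transitivity
  (Q * a' * (Y a * F - a * Y F - (X b * F - b * X F))
   - Q * a * (Y a' * F - a' * Y F - (X b' * F - b' * X F))
   + F * a' * (X P * a + P * X a + (X Q * b + Q * X b))
   - F * a * (X P * a' + P * X a' + (X Q * b' + Q * X b'))
   + (Q * X F + F * X Q) * (a * b' - a' * b)); first by ring.
by rewrite c c' Xe Xe' E !subrr !mulr0 !(addr0, subr0).
Qed.

(** The second relation is taken with a zero at an index where the first one is
    nonzero, which makes the two independent. *)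
Lemma two_relations (K : fieldType) (M : nat) (W : 'M[K]_(M.+2, M)) :
  exists u v : 'rV[K]_M.+2, [/\ u *m W = 0, v *m W = 0 &
    forall a b, a *: u + b *: v = 0 -> a = 0 /\ b = 0].
Proof.
have kernel n m (Z : 'M[K]_(n, m)) : (m < n)%N ->
    exists2 u : 'rV[K]_n, u != 0 & u *m Z = 0.
  move=> mn; have : kermx Z != 0.
    rewrite kermx_eq0 /row_free; apply/eqP => h.
    by have := rank_leq_col Z; rewrite h leqNgt mn.
  by move=> /rowV0Pn[u /sub_kermxP uZ u0]; exists u.
have [u u0 uW] := kernel _ _ W (leqnSn _).
have [i ui] : exists i, u 0 i != 0.
  apply/existsP; apply: contraNT u0; rewrite negb_exists => /forallP h.
  by apply/eqP/rowP => j; rewrite mxE; apply/eqP/negPn/h.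
have [v v0] := kernel _ _ (row_mx W (delta_mx i (@ord0 0))) (eq_leq (addn1 _)).
rewrite mul_mx_row -[RHS]row_mx0 => /eq_row_mx[vW vi].
exists u, v; split=> // a b h.
have vi0 : v 0 i = 0.
  by have /matrixP/(_ 0 0) := vi; rewrite -colE !mxE.
have a0 : a = 0.
  have /rowP/(_ i) := h; rewrite !mxE vi0 mulr0 addr0 => /eqP.
  by rewrite mulf_eq0 (negPf ui) orbF => /eqP.
split=> //; move: h; rewrite a0 scale0r add0r => /eqP.
by rewrite scaler_eq0 (negPf v0) orbF => /eqP.
Qed.

Section Darboux.
Variables (K : numFieldType) (xi : 2.-tuple (mpoly 2 K)).
Variables (n : nat) (f k : 'I_n -> mpoly 2 K) (p : 'I_n -> 'rV[K]_2).
Hypothesis f0 : forall j, f j != 0.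
Hypothesis fP : forall j h, orbit_ideal xi (p j) h <-> exists g, h = g * f j.
Hypothesis fk : forall j, lie xi (f j) = k j * f j.
Hypothesis fN : forall i j, i != j -> ~ orbit_ideal xi (p j) (f i).

Implicit Types u v : 'rV[K]_n.
Let G j := \prod_(l | l != j) f l.
Let F := \prod_l f l.

Let FE j : F = f j * G j.
Proof. by rewrite /F (bigD1 j). Qed.

Let F0 : F != 0.
Proof. by apply/prodf_neq0 => j _. Qed.

(** The [dx_i]-component of [F * \sum_j u_j df_j / f_j]. *)
Definition log_form (u : 'rV[K]_n) i : mpoly 2 K :=
  \sum_j u 0 j *: (G j * mderiv i (f j)).

Lemma log_formD a b u v i :
  log_form (a *: u + b *: v) i = a *: log_form u i + b *: log_form v i.
Proof.
rewrite /log_form !scaler_sumr -big_split; apply: eq_bigr => j _.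
by rewrite !mxE scalerDl !scalerA.
Qed.

(** The field sends [df_j / f_j] to the cofactor [k_j]. *)
Lemma log_form_xi u : \sum_j u 0 j *: k j = 0 ->
  \sum_i tnth xi i * log_form u i = 0.
Proof.
move=> h; transitivity ((\sum_j u 0 j *: k j) * F); last by rewrite h mul0r.
under eq_bigr do rewrite mulr_sumr.
rewrite exchange_big mulr_suml; apply: eq_bigr => j _ /=.
rewrite (FE j) -scalerAl mulrA -fk mulr_suml scaler_sumr.
by apply: eq_bigr => i _; rewrite -scalerAr -mulrA [_ * G j]mulrC.
Qed.

(** Each [df_j / f_j] is closed. *)
Lemma log_form_closed u i i' :
  mderiv i' (log_form u i) * F - log_form u i * mderiv i' F =
  mderiv i (log_form u i') * F - log_form u i' * mderiv i F.
Proof.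
rewrite /log_form !raddf_sum !mulr_suml /= -!sumrB; apply: eq_bigr => j _.
rewrite !mderivZ -!scalerAl -!scalerBr; congr (_ *: _).
by rewrite (FE j) !mderivM (mderiv_comm i i'); ring.
Qed.

(** The residue along the curve [f_j = 0] of the form [\sum_j u_j df_j / f_j] is
    [u_j]: modulo the prime ideal of [p j] only the [j]-th term survives, and
    not all partial derivatives of [f_j] are in this ideal: it is generated by
    [f_j] itself, which has larger degree, and they are not all zero because
    [f_j] is not constant. *)
Lemma log_form_eq0 u : (forall i, log_form u i = 0) -> u = 0.
Proof.
move=> h; apply/rowP => j; rewrite mxE; apply/eqP/negPn/negP => uj.
have fj i : orbit_ideal xi (p j) (mderiv i (f j)).
  have GN : ~ orbit_ideal xi (p j) (G j).
    by move/orbit_ideal_prod => [l lj]; apply: fN.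
  have : orbit_ideal xi (p j) (u 0 j *: (G j * mderiv i (f j))).
    have := h i; rewrite /log_form (bigD1 j) //= => /eqP.
    rewrite addr_eq0 => /eqP ->; rewrite -sub0r.
    apply: orbit_idealB; first exact: orbit_ideal0.
    apply: orbit_ideal_sum => l lj; rewrite -mul_mpolyC; apply: orbit_idealM.
    rewrite mulrC; apply: orbit_idealM.
    rewrite /G (bigD1 j) 1?eq_sym //= mulrC; apply: orbit_idealM.
    by apply/fP; exists 1; rewrite mul1r.
  rewrite -mul_mpolyC => /orbit_ideal_prime[/orbit_idealC/eqP|].
    by rewrite (negPf uj).
  by move=> /orbit_ideal_prime[].
have d0 i : mderiv i (f j) = 0.
  have [g eg] := (fP j _).1 (fj i).
  apply/eqP/negPn/negP => d0.
  have g0 : g != 0 by apply: contraNneq d0 => g0; rewrite eg g0 mul0r.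
  have := msize_mderiv i (f j); rewrite eg msizeM //.
  have := msize_poly_eq0 g; have := msize_poly_eq0 (f j).
  rewrite (negPf g0) (negPf (f0 j)).
  by move: (msize g) (msize (f j)) => [|a] [|b] // _ _; rewrite /= addnS ltnNge leq_addl.
have := f0 j; rewrite (mderiv_eq0_const d0) => /eqP; apply.
suff -> : mcoeff mnm0 (f j) = 0 by rewrite mpolyC0.
apply: (@orbit_idealC _ _ xi (p j)); rewrite -(mderiv_eq0_const d0).
by apply/fP; exists 1; rewrite mul1r.
Qed.

(** One of the two components of the field is nonzero, say along the index [i'];
    the first integral is then the ratio of the components of index [i] of the
    two forms. *)
Lemma log_forms_first_integral u v q : ~ Sing xi q ->
  \sum_j u 0 j *: k j = 0 -> \sum_j v 0 j *: k j = 0 ->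
  (forall a b, a *: u + b *: v = 0 -> a = 0 /\ b = 0) ->
  exists a a' : mpoly 2 K, lie xi a * a' = a * lie xi a' /\
    forall c d, c%:MP * a + d%:MP * a' = 0 -> c = 0 /\ d = 0.
Proof.
move=> nS hu hv ind.
have [i [i' [ii' xi0 lieE sumE]]] : exists i i' : 'I_2,
    [/\ i != i', tnth xi i' != 0, forall h, lie xi h = tnth xi i * mderiv i h +
       tnth xi i' * mderiv i' h &
    forall w, \sum_i tnth xi i * log_form w i =
      tnth xi i * log_form w i + tnth xi i' * log_form w i'].
  have s2 (T : 'I_2 -> mpoly 2 K) : \sum_i T i = T 0 + T 1.
    by rewrite big_ord_recl big_ord1; congr (_ + T _); apply: val_inj.
  have [e1|e1] := eqVneq (tnth xi 1) 0; last first.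
    by exists 0, 1; split=> // h; rewrite ?/lie s2.
  exists 1, 0; split=> // [|h|w]; try by rewrite ?/lie s2 addrC.
  apply: contra_notN nS => /eqP e0 j.
  have [->|->] : j = 0 \/ j = 1.
  - by case: j => [[|[|]]] // ?; [left|right]; apply: val_inj.
  - by rewrite e0 [pt_eval _ _]meval0.
  - by rewrite e1 [pt_eval _ _]meval0.
exists (log_form u i), (log_form v i); split.
  rewrite !lieE; apply: (@first_integral _ _ _ _ _ _ (log_form u i') _ (log_form v i') F) => //.
  - exact: mderivD.
  - exact: mderivM.
  - by rewrite -sumE log_form_xi.
  - by rewrite -sumE log_form_xi.
  - exact: log_form_closed.
  - exact: log_form_closed.
move=> c d; rewrite !mul_mpolyC -log_formD => h; apply: ind.
apply: log_form_eq0 => j.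
have h' : log_form (c *: u + d *: v) i' = 0.
  have := sumE (c *: u + d *: v); rewrite log_form_xi.
    by rewrite h mulr0 add0r => /esym/eqP; rewrite mulf_eq0 (negPf xi0) => /eqP.
  under eq_bigr do rewrite !mxE scalerDl -!scalerA.
  by rewrite big_split -!scaler_sumr /= hu hv !scaler0 addr0.
suff [->|->] : j = i \/ j = i' by [].
have [|ji] := eqVneq j i; first by left.
right; apply: val_inj; move: ii' ji; rewrite -!val_eqE /=.
by move: (ltn_ord i) (ltn_ord i') (ltn_ord j); lia.
Qed.

End Darboux.

(** * A uniform degree bound *)

Section DegreeBound.
Variables (K : numClosedFieldType) (xi : 2.-tuple (mpoly 2 K)).

Let s := (\max_i msize (tnth xi i))%N.

Let M := #|{: bmultinom 2 s}|.

Lemma msize_cofactor (f k : mpoly 2 K) :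
  f != 0 -> lie xi f = k * f -> (msize k <= s)%N.
Proof.
move=> f0 e; have [->|k0] := eqVneq k 0; first by rewrite mmeasure0.
have : (msize (lie xi f) <= s + (msize f).-1)%N.
  apply: (leq_trans (mmeasure_sum _ _ _ _)); apply/bigmax_leqP => i _.
  apply: (@leq_trans (msize (tnth xi i) + msize (mderiv i f))%N).
    have [->|P0] := eqVneq (tnth xi i) 0; first by rewrite mul0r mmeasure0.
    have [->|d0] := eqVneq (mderiv i f) 0; first by rewrite mulr0 mmeasure0.
    by rewrite msizeM // leq_pred.
  apply: leq_add; last exact: msize_mderiv.
  exact: (leq_bigmax (F := fun i => msize (tnth xi i)) i).
rewrite e msizeM //; have := msize_poly_eq0 f; rewrite (negPf f0).
by case: (msize f) => // a _; rewrite addnS leq_add2r.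
Qed.

Lemma coef_relation (n : nat) (k : 'I_n -> mpoly 2 K)
    (W : 'M[K]_(n, M)) (u : 'rV[K]_n) :
  (forall j, (msize (k j) <= s)%N) ->
  W = \matrix_(j, t) mcoeff (bmnm (enum_val t)) (k j) ->
  u *m W = 0 -> \sum_j u 0 j *: k j = 0.
Proof.
move=> hk -> uW; apply/mpolyP => m; rewrite mcoeff0 raddf_sum /=.
case: (ltnP (mdeg m) s) => ms; last first.
  apply: big1 => j _; rewrite mcoeffZ memN_msupp_eq0 ?mulr0 //.
  exact/msize_mdeg_ge/(leq_trans (hk j)).
have /rowP/(_ (enum_rank (BMultinom ms))) := uW; rewrite !mxE => e.
by apply: etrans e; apply: eq_bigr => j _; rewrite mcoeffZ !mxE enum_rankK.
Qed.

Definition is_orbit_generator p f :=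
  f != 0 /\ forall h, orbit_ideal xi p h <-> exists g, h = g * f.

Lemma generator_msize p f h : is_orbit_generator p f -> h != 0 ->
  orbit_ideal xi p h -> (msize f <= msize h)%N.
Proof.
move=> [f0 fP] h0 /fP[g eg].
have g0 : g != 0 by apply: contraNneq h0 => g0; rewrite eg g0 mul0r.
rewrite eg msizeM //; have := msize_poly_eq0 g; rewrite (negPf g0).
by case: (msize g) => // a _; rewrite addSn leq_addl.
Qed.

(** Generators of comparable orbit ideals differ by a unit: if [f] divides [f'],
    the cofactor is not in the prime ideal of [f'], so that [f] is. *)
Lemma generator_msize_eq p p' f f' :
  is_orbit_generator p f -> is_orbit_generator p' f' ->
  orbit_ideal xi p f' -> msize f = msize f'.
Proof.
move=> gf gf' h; have [f0 fP] := gf; have [f'0 f'P] := gf'.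
have [g eg] := (fP _).1 h.
have hf' : orbit_ideal xi p' f' by apply/f'P; exists 1; rewrite mul1r.
apply/eqP; rewrite eqn_leq (generator_msize gf) //=.
have g0 : g != 0 by apply: contraNneq f'0 => g0; rewrite eg g0 mul0r.
move: (hf'); rewrite {1}eg => /orbit_ideal_prime[/f'P[g' eg']|hf]; last first.
  exact: generator_msize gf' f0 hf.
have : g' * f = 1.
  by apply: (mulIf f'0); rewrite mul1r {2}eg eg' mulrAC.
move=> gf1; case: (@orbit_ideal1 _ _ xi p); apply/fP; exists g'.
by rewrite gf1.
Qed.

(** Darboux and Jouanolou.  If the degrees were unbounded there would be
    generators [f 0], [f 1], ... of strictly increasing degrees, which define
    invariant curves, none of which contains the orbit of another.
    Sufficiently many of them give a first integral [a / a'].  Every orbit ideal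
    then contains a nonzero combination of [a] and [a'], and this bounds the
    degree of its generator. *)
Lemma generators_bounded : exists d, forall p f,
  ~ Sing xi p -> is_orbit_generator p f -> (msize f <= d)%N.
Proof.
apply: contrapT => unb.
have /boolp.choice[pf pfP] (d : nat) : exists x : 'rV[K]_2 * mpoly 2 K,
    [/\ ~ Sing xi x.1, is_orbit_generator x.1 x.2 & (d < msize x.2)%N].
  apply: contrapT => h; apply: unb; exists d => p f nS gf.
  by rewrite leqNgt; apply/negP => lt; apply: h; exists (p, f).
(* [d] is chosen such that the degrees of the [f j] strictly increase. *)
pose d := fix d j := if j is j'.+1 then msize (pf (d j')).2 else 0%N.
pose p j := (pf (d j)).1; pose f j := (pf (d j)).2.
have nS j : ~ Sing xi (p j) by have [] := pfP (d j).
have gen j : is_orbit_generator (p j) (f j) by have [] := pfP (d j).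
have fS j : (msize (f j) < msize (f j.+1))%N by have [_ _ +] := pfP (d j.+1).
have f_lt i j : (i < j)%N -> (msize (f i) < msize (f j))%N.
  elim: j => // j IH; rewrite ltnS leq_eqVlt => /predU1P[->|/IH lt] //.
  exact: ltn_trans lt (fS j).
have /boolp.choice[k kP] j : exists k, lie xi (f j) = k * f j.
  apply/(gen j).2; apply: orbit_ideal_lie; apply/(gen j).2.
  by exists 1; rewrite mul1r.

pose W : 'M[K]_(M.+2, M) := \matrix_(j, t) mcoeff (bmnm (enum_val t)) (k j).
have [u [v [uW vW ind]]] := two_relations W.
have rel (w : 'rV[K]_M.+2) : w *m W = 0 -> \sum_j w 0 j *: k (j : 'I_M.+2) = 0.
  move=> hw; apply: (coef_relation _ (erefl W) hw) => j.
  by apply: msize_cofactor (kP j); apply: (gen j).1.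
have [||||a [a' [aa' ind']]] := @log_forms_first_integral K xi M.+2 (fun j => f j)
  (fun j => k j) (fun j => p j) _ _ _ _ u v _ (nS 0%N) (rel _ uW) (rel _ vW) ind.
- by move=> j; apply: (gen j).1.
- by move=> j; apply: (gen j).2.
- by move=> j; apply: kP.
- move=> i j ij /(generator_msize_eq (gen j) (gen i)) e.
  by case: (ltngtP i j) => [/f_lt|/f_lt|/val_inj/eqP]; rewrite ?e ?ltnn // (negPf ij).
pose N := (maxn (msize a) (msize a')).
have [_ genN ltN] := pfP N.
have [c [c' [cc' h]]] := wronskian_dependent (ev := meval (fun i => (pf N).1 ord0 i))
  (@lieD _ _ xi) (@lieM _ _ xi) (@lieC _ _ xi) (mevalC _) aa'.
have h0 : c%:MP * a + c'%:MP * a' != 0.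
  apply/eqP => /ind'[c0 c'0]; move: cc'; rewrite c0 c'0 eqxx.
  by [].
have := generator_msize genN h0 h; apply/negP; rewrite -ltnNge.
apply: leq_ltn_trans ltN; apply: leq_trans (msizeD_le _ _) _.
by rewrite !mul_mpolyC geq_max /N !leq_max !mmeasureZ_le orbT.
Qed.

(** At a singular point the two linear forms [x_i - p_i] suffice, and elsewhere
    the generator does. *)
Lemma orbit_ideal_bounded : exists d, forall p q,
  (forall f, orbit_ideal xi p f -> (msize f <= d)%N -> pt_eval f q = 0) ->
  forall f, orbit_ideal xi p f -> pt_eval f q = 0.
Proof.
have [d hd] := generators_bounded; exists (maxn d 2) => p q hq f hf.
case: (pselect (Sing xi p)) => [sp|nS].
  suff <- : p = q by apply: orbit_ideal_eval hf.
  apply/rowP => i; apply/esym/eqP; rewrite -subr_eq0; apply/eqP.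
  have := hq ('X_i - (p ord0 i)%:MP).
  rewrite [pt_eval _ _]mevalB mevalXU mevalC; apply.
    apply: orbit_ideal_Sing => //.
    by rewrite [pt_eval _ _]mevalB mevalXU mevalC subrr.
  rewrite -mpolyCN; apply: leq_trans (msizeD_le _ _) _.
  rewrite geq_max !leq_max; apply/andP; split; apply/orP; right.
    by rewrite msizeX mdeg1.
  by rewrite msizeC; case: (_ != _).
have [g gP] := orbit_ideal_principal nS.
have [g0|g0] := eqVneq g 0.
  by have [h ->] := (gP f).1 hf; rewrite g0 mulr0 [pt_eval _ _]meval0.
have gen : is_orbit_generator p g by split.
have [h ->] := (gP f).1 hf; rewrite [pt_eval _ _]mevalM [X in _ * X]hq ?mulr0 //.
  by apply/gP; exists 1; rewrite mul1r.
by rewrite leq_max (hd p).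
Qed.

End DegreeBound.

(** * Constructibility of rank conditions *)

Section Constructible.
Variables (K : fieldType) (n : nat).
Implicit Types (A B : set 'rV[K]_n) (z : 'rV[K]_n).

Lemma zariski_closureP A q : zariski_closure A q <->
  forall f, (forall x, A x -> pt_eval f x = 0) -> pt_eval f q = 0.
Proof.
split=> [h f hf|h B [[I ->] AB] f If].
  apply: (h (zero_locus [set f])); last by [].
  by split; [exists [set f]|move=> x Ax g ->; apply: hf].
by apply: h => x Ax; apply: AB.
Qed.

Lemma constructible_zeros (f : mpoly n K) :
  constructible [set z | pt_eval f z = 0].
Proof.
apply: constructible_closed; exists [set f]; apply/seteqP; split=> z /=.
  by move=> h g ->.
exact.
Qed.

Lemma constructible_forall (J : finType) (A : J -> set 'rV[K]_n) :
  (forall j, constructible (A j)) -> constructible [set z | forall j, A j z].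
Proof.
move=> hA.
have -> : [set z | forall j, A j z] =
    [set z | forall j, j \in enum J -> A j z].
  apply/seteqP; split=> z /= h j; first by move=> _; apply: h.
  by apply: h; rewrite mem_enum.
elim: (enum J) => [|i r IH].
  have -> : [set z | forall j, j \in [::] -> A j z] =
      [set z | pt_eval (0 : mpoly n K) z = 0].
    by apply/seteqP; split=> z //= _; rewrite [pt_eval _ _]meval0.
  exact: constructible_zeros.
have -> : [set z | forall j, j \in i :: r -> A j z] =
    A i `&` [set z | forall j, j \in r -> A j z].
  apply/seteqP; split=> z /=.
    move=> h; split=> [|j jr]; first by apply: h; rewrite mem_head.
    by apply: h; rewrite inE jr orbT.
  by move=> [Ai h] j; rewrite inE => /predU1P[->|/h].
exact: constructibleI.
Qed.

Lemma constructible_impl A B : constructible A -> constructible B ->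
  constructible [set z | A z -> B z].
Proof.
move=> hA hB.
have -> : [set z | A z -> B z] = ~` (A `&` ~` B).
  apply/seteqP; split=> z /=; first by move=> h [/h].
  by move=> h Az; apply: contrapT => nB; apply: h.
by apply: constructibleC; apply: constructibleI => //; apply: constructibleC.
Qed.

Definition eval_mx a b (A : 'M[mpoly n K]_(a, b)) z : 'M[K]_(a, b) :=
  map_mx (fun f => pt_eval f z) A.

Lemma rank_geP a b (A : 'M[K]_(a, b)) r :
  (r <= \rank A)%N <-> exists (g : {ffun 'I_r -> 'I_a}) (h : {ffun 'I_r -> 'I_b}),
    \det (mxsub g h A) != 0.
Proof.
split=> [rA|[g [h dA]]]; last first.
  have : row_free (mxsub g h A) by rewrite row_free_unit unitmxE unitfE.
  rewrite /row_free => /eqP {1}<-; rewrite -[A in mxsub _ _ A]mulmx1 mxsub_mul.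
  by apply: leq_trans (mxrankM_maxl _ _) _; apply/mxrankS/rowsub_sub.
pose A0 := rowsub (maxrankfun A) A; pose w := widen_ord rA.
pose A1 := rowsub w A0.
have f1 : row_full A1^T.
  rewrite /row_full mxrank_tr -/(row_free A1).
  have /row_freeP[B AB] : row_free A0 by apply: maxrowsub_free.
  apply/row_freeP; exists (B *m (rowsub w 1%:M)^T); rewrite mulmxA.
  have -> : A1 *m B = rowsub w 1%:M by rewrite -AB mxsub_mul mxsub_id.
  apply/matrixP => x y; rewrite !mxE (bigD1 (w x)) //= !mxE eqxx mul1r.
  rewrite big1 ?addr0 => [|z /negPf zx]; last by rewrite !mxE eq_sym zx mul0r.
  by rewrite -!val_eqE /= eq_sym.
have uA2 : rowsub (fullrankfun f1) A1^T \in unitmx by apply: fullrowsub_unit.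
exists [ffun x => maxrankfun A (w x)], (fullrankfun f1).
move: uA2; rewrite unitmxE unitfE -det_tr; congr (\det _ != 0).
by apply/matrixP => x y; rewrite !mxE; congr (A _ _); rewrite [RHS]ffunE.
Qed.

(** The rank is at least [r] iff some minor of order [r] is nonzero. *)
Lemma constructible_rank_ge a b (A : 'M[mpoly n K]_(a, b)) r :
  constructible [set z | (r <= \rank (eval_mx A z))%N].
Proof.
have -> : [set z | (r <= \rank (eval_mx A z))%N] =
    ~` [set z | forall gh : {ffun 'I_r -> 'I_a} * {ffun 'I_r -> 'I_b},
          pt_eval (\det (mxsub gh.1 gh.2 A)) z = 0].
  have evd g h z : pt_eval (\det (mxsub g h A)) z = \det (mxsub g h (eval_mx A z)).
    by rewrite -map_mxsub /pt_eval /= -det_map_mx.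
  apply/seteqP; split=> z /=.
    by move=> /rank_geP[g [h /eqP d0]] /(_ (g, h)); rewrite evd => /d0.
  move=> nh; apply/rank_geP; apply: contrapT => ne; apply: nh => -[g h].
  rewrite evd /=; apply/eqP/negPn/negP => d0; apply: ne.
  by exists g, h.
by apply/constructibleC/constructible_forall => gh; apply: constructible_zeros.
Qed.

(** A row belongs to the row space of a matrix iff adjoining it does not raise
    the rank. *)
Lemma constructible_submx a b (A : 'M[mpoly n K]_(a, b)) (v : 'rV[mpoly n K]_b) :
  constructible [set z | (eval_mx v z <= eval_mx A z)%MS].
Proof.
have -> : [set z | (eval_mx v z <= eval_mx A z)%MS] =
    [set z | forall r : 'I_b.+1, (r <= \rank (eval_mx (col_mx A v) z))%N ->
       (r <= \rank (eval_mx A z))%N].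
  apply/seteqP; split=> z /=; rewrite /eval_mx map_col_mx.
    by move=> h r /leq_trans; apply; rewrite -addsmxE; apply: mxrankS; rewrite addsmx_sub submx_refl.
  set A' := map_mx _ A; set v' := map_mx _ v => h.
  have le : (\rank (col_mx A' v') <= \rank A')%N.
    have lt : (\rank (col_mx A' v') < b.+1)%N by rewrite ltnS rank_leq_col.
    exact: (h (Ordinal lt)).
  have : (A' <= col_mx A' v')%MS by rewrite -addsmxE addsmxSl.
  move=> /mxrank_leqif_eq[_]; rewrite eqn_leq le mxrankS -?addsmxE ?addsmxSl //=.
  by move=> /esym; apply: submx_trans; apply: addsmxSr.
apply: constructible_forall => r.
by apply: constructible_impl; apply: constructible_rank_ge.
Qed.

End Constructible.

Section JetsFinite.
Variables (K : numFieldType) (xi : 2.-tuple (mpoly 2 K)).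

(** The sequence of the vectors [(xi^k m_j)_j] stays in the span of its first [N]
    terms as soon as its [N]-th term does, because the span is then stable under
    the Lie derivative.  For one polynomial this is a linear differential
    system for its Lie derivatives along the integral curves; for the monomials
    of bounded degree it is a finite system of equations for the elements of
    bounded degree of the orbit ideals, uniform in the point. *)
Lemma lie_jets_finite M (m : 'I_M -> mpoly 2 K) :
  exists N, forall k, in_span (fun k => \row_j iter k (lie xi) (m j)) N
    (\row_j iter k (lie xi) (m j)).
Proof.
pose w k := \row_j iter k (lie xi) (m j).
have [N hN] := spans_stabilize_plane w; exists N.
have wS k : map_mx (lie xi) (w k) = w k.+1 by apply/rowP => j; rewrite !mxE.
elim=> [|k [c hc]].
  by case: N hN => [//|N] _; apply: (in_span_gen w).
rewrite -/(w k) in hc; rewrite -/(w k.+1) -wS hc.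
have -> : map_mx (lie xi) (\sum_(i < N) c i *: w i) =
    \sum_(i < N) (lie xi (c i) *: w i + c i *: w i.+1).
  apply/rowP => j; rewrite mxE !summxE (big_morph _ (@lieD _ _ xi) (iter_deriv0 (@lieD _ _ xi) 1)).
  by apply: eq_bigr => i _; rewrite -wS !mxE lieM.
apply: in_span_sum => i; apply: in_spanD; apply: in_spanZ.
  exact: (in_span_gen w).
have := ltn_ord i; rewrite leq_eqVlt => /predU1P[->//|iN].
exact: (in_span_gen w).
Qed.

End JetsFinite.

(** Write [f = \sum_j a_j m_j] with monomials [m_j] of degree less than [d].  Then
    [f] is in the orbit ideal of [p] iff [A(p) a = 0], with rows indexed by the
    finitely many [k < N].  All these [f] vanish at [q] iff the row [(m_j(q))_j]
    is in the row space of [A(p)]. *)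
Lemma constructible_orbit_ideal_relation (K : numClosedFieldType)
    (xi : 2.-tuple (mpoly 2 K)) :
  constructible [set z : 'rV[K]_(2 + 2) |
    forall f, orbit_ideal xi (lsubmx z) f -> pt_eval f (rsubmx z) = 0].
Proof.
have [d hd] := orbit_ideal_bounded xi.
pose M := #|{: bmultinom 2 d}|.
pose mono (j : 'I_M) : mpoly 2 K := 'X_[bmnm (enum_val j)].
have monoE (f : mpoly 2 K) : (msize f <= d)%N ->
    f = \sum_j (mcoeff (bmnm (enum_val j)) f)%:MP * mono j.
  move=> /mpolywE {1}->; rewrite (reindex _ (onW_bij _ (@enum_val_bij _))) /=.
  by apply: eq_bigr => j _; rewrite mul_mpolyC.
have [N hN] := lie_jets_finite xi mono.
(* [z] in the space of dimension four stands for the pair [(p, q)]. *)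
pose incl (h : 'I_2 -> 'I_(2 + 2)) (f : mpoly 2 K) : mpoly (2 + 2) K :=
  comp_mpoly [tuple 'X_(h i) | i < 2] f.
have inclE h f z : pt_eval (incl h f) z = meval (fun i => z ord0 (h i)) f.
  rewrite /pt_eval comp_mpoly_meval; apply: meval_eq => i.
  by rewrite tnth_mktuple mevalXU.
have inclL f z : pt_eval (incl (@lshift 2 2) f) z = pt_eval f (lsubmx z).
  by rewrite inclE; apply: meval_eq => i; rewrite mxE.
have inclR f z : pt_eval (incl (@rshift 2 2) f) z = pt_eval f (rsubmx z).
  by rewrite inclE; apply: meval_eq => i; rewrite mxE.
pose A := \matrix_(j < M, k < N) incl (@lshift 2 2) (iter k (lie xi) (mono j)).
pose v := \row_(j < M) incl (@rshift 2 2) (mono j).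
pose comb (a : 'I_M -> K) := \sum_j (a j)%:MP * mono j.
have comb_iter a k p : pt_eval (iter k (lie xi) (comb a)) p =
    \sum_j a j * pt_eval (iter k (lie xi) (mono j)) p.
  rewrite (iter_deriv_sum (@lieD _ _ xi)) [pt_eval _ _]rmorph_sum.
  apply: eq_bigr => j _.
  apply: (jetZ (ev := meval (fun i => p ord0 i)) (@lieM _ _ xi)); last exact: lieC.
  by move=> g; rewrite rmorphM /= mevalC.
have comb_ideal a p : (forall k, (k < N)%N ->
      \sum_j a j * pt_eval (iter k (lie xi) (mono j)) p = 0) ->
    orbit_ideal xi p (comb a).
  move=> h k; rewrite comb_iter; have [c hc] := hN k.
  transitivity (\sum_j a j * pt_eval (\sum_(i < N) c i * iter i (lie xi) (mono j)) p).
    apply: eq_bigr => j _; congr (_ * pt_eval _ _).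
    have /rowP/(_ j) := hc; rewrite mxE => ->; rewrite summxE.
    by apply: eq_bigr => i _; rewrite !mxE.
  under eq_bigr do rewrite [pt_eval _ _]rmorph_sum mulr_sumr.
  rewrite exchange_big big1 // => i _.
  transitivity (pt_eval (c i) p * \sum_j a j * pt_eval (iter i (lie xi) (mono j)) p).
    rewrite mulr_sumr; apply: eq_bigr => j _.
    by rewrite [RHS]mulrCA; congr (_ * _); apply: mevalM.
  by rewrite h ?mulr0.
have -> : [set z : 'rV[K]_(2 + 2) |
    forall f, orbit_ideal xi (lsubmx z) f -> pt_eval f (rsubmx z) = 0] =
    [set z | (eval_mx v z <= (eval_mx A^T z))%MS].
  apply/seteqP; split=> z /=.
    move=> h; rewrite submxE; have CP := mulmx_coker (eval_mx A^T z).
    move: (cokermx _) CP => C CP; apply/eqP/rowP => l; rewrite [RHS]mxE.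
    (* The columns of the cokernel are solutions of the system. *)
    pose a j := C j l.
    have /h : orbit_ideal xi (lsubmx z) (comb a).
      apply: comb_ideal => k kN.
      have /matrixP/(_ (Ordinal kN) l) := CP.
      rewrite !mxE => e; apply: etrans e; apply: eq_bigr => j _.
      by rewrite !mxE inclL mulrC.
    rewrite (comb_iter a 0%N) mxE => e; apply: etrans e.
    by apply: eq_bigr => j _; rewrite !mxE inclR mulrC.
  move=> /submxP[D vD]; apply: hd => f hf /monoE fE.
  pose a (j : 'I_M) := mcoeff (bmnm (enum_val j)) f.
  rewrite -/(comb a) in fE; rewrite {1}fE; rewrite {}fE in hf.
  have := comb_iter a 0%N (rsubmx z); rewrite [iter 0 _ _]/= => ->.
  transitivity (\sum_k D 0 k * pt_eval (iter k (lie xi) (comb a)) (lsubmx z)).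
    under [RHS]eq_bigr do rewrite comb_iter mulr_sumr.
    rewrite exchange_big; apply: eq_bigr => j _ /=.
    have /rowP/(_ j) := vD; rewrite !mxE inclR => ->; rewrite mulr_sumr.
    by apply: eq_bigr => k _; rewrite !mxE inclL mulrCA.
  by apply: big1 => k _; rewrite hf mulr0.
exact: constructible_submx.
Qed.

(** * Derivatives along integral curves *)

Lemma is_derive_eps (K : numFieldType) (g : K -> K) (t d : K) :
  is_derive t 1 g d <-> forall e, 0 < e -> exists2 r, 0 < r &
    forall h, `|h| < r -> `|g (h + t) - g t - h * d| <= e * `|h|.
Proof.
have lim_eps : (h^-1 *: ((g \o shift t) (h *: 1) - g t) @[h --> 0^'] --> d) <->
    forall e, 0 < e -> exists2 r, 0 < r &
    forall h, `|h| < r -> `|g (h + t) - g t - h * d| <= e * `|h|.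
  split=> [/cvgrPdist_le lim e e0|lim].
    have := lim _ e0; rewrite near_withinE => /nbhs_ballP[r /= r0 hr].
    exists r => // h hlt; have [->|h0] := eqVneq h 0.
      by rewrite add0r subrr mul0r subr0 normr0 mulr0.
    have := hr h; rewrite /ball /= sub0r normrN => /(_ hlt h0).
    rewrite [_ *: 1]mulr1 /= -[_ *: _]/(_ * _) => le.
    have -> : g (h + t) - g t - h * d = - h * (d - h^-1 * (g (h + t) - g t)).
      by field.
    by rewrite normrM normrN mulrC ler_wpM2r.
  apply/cvgrPdist_le => e e0; have [r r0 hr] := lim e e0.
  rewrite near_withinE; apply/nbhs_ballP; exists r => //= h.
  rewrite /ball /= sub0r normrN => hlt h0.
  rewrite [_ *: 1]mulr1 /= -[_ *: _]/(_ * _).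
  have -> : d - h^-1 * (g (h + t) - g t) = - h^-1 * (g (h + t) - g t - h * d).
    by field.
  by rewrite normrM normrN normfV ler_pdivrMl ?normr_gt0 // [_ * e]mulrC hr.
split=> [h|/lim_eps lim].
  apply/lim_eps; rewrite -(derive_val (is_derive := h)).
  exact: (@ex_derive _ _ _ _ _ _ _ h).
apply: DeriveDef; first by apply/cvg_ex; exists d.
exact: cvg_lim.
Qed.

Lemma is_derive_mul (K : numFieldType) (f g : K -> K) (t df dg : K) :
  is_derive t 1 f df -> is_derive t 1 g dg ->
  is_derive t 1 (fun s => f s * g s) (df * g t + f t * dg).
Proof.
move=> hf hg; apply: (is_derive_eq (is_deriveM hf hg)).
by rewrite addrC; congr (_ + _); rewrite [RHS]mulrC.
Qed.

Lemma mpoly_ring_ind n (K : nzRingType) (P : mpoly n K -> Prop) :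
  (forall c, P c%:MP) -> (forall i, P 'X_i) ->
  (forall f g, P f -> P g -> P (f + g)) ->
  (forall f g, P f -> P g -> P (f * g)) -> forall f, P f.
Proof.
move=> PC PX PD PM; elim/mpolyind => [|c m f _ _ Pf].
  by rewrite -mpolyC0.
apply: (PD) => //; rewrite -mul_mpolyC; apply: (PM) => //.
rewrite mpolyXE_id; elim/big_rec: _ => [|i g _ Pg].
  by rewrite -mpolyC1.
apply: (PM) => //; elim: (m i) => [|k IH]; first by rewrite expr0 -mpolyC1.
by rewrite exprS; apply: PM.
Qed.

(** The chain rule. *)
Lemma is_derive_along_curve (K : numFieldType) n (xi : n.-tuple (mpoly n K))
    (D : set K) gamma f t :
  integral_curve xi D gamma -> D t ->
  is_derive t 1 (fun s => pt_eval f (gamma s)) (pt_eval (lie xi f) (gamma t)).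
Proof.
move=> hg Dt; elim/mpoly_ring_ind: f => [c|i|f g hf hh|f g hf hh].
- rewrite (_ : (fun s => _) = cst c); last first.
    by apply/funext => s; rewrite [pt_eval _ _]mevalC.
  by rewrite lieC [pt_eval _ _]meval0; apply: is_derive_cst.
- rewrite (_ : (fun s => _) = (fun s => gamma s ord0 i)); last first.
    by apply/funext => s; rewrite [pt_eval _ _]mevalXU.
  by rewrite lieX; apply: hg.
- rewrite (_ : (fun s => _) =
    (fun s => pt_eval f (gamma s)) + (fun s => pt_eval g (gamma s))); last first.
    by apply/funext => s; rewrite [pt_eval _ _]mevalD.
  by rewrite lieD [pt_eval _ _]mevalD; apply: is_deriveD.
rewrite (_ : (fun s => _) =
    (fun s => pt_eval f (gamma s) * pt_eval g (gamma s))); last first.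
  by apply/funext => s; rewrite [pt_eval _ _]mevalM.
rewrite lieM [pt_eval (_ + _) _]mevalD !mevalM; exact: is_derive_mul.
Qed.

(** Gronwall: [expR (- C * s) * y s] is nonincreasing. *)
Lemma gronwall_zero (R : realType) (y y' : R -> R) (C : R) :
  (forall s : R, 0 <= s <= 1 -> is_derive s 1 y (y' s)) ->
  (forall s : R, 0 <= s <= 1 -> y' s <= C * y s) ->
  y 0 = 0 -> y 1 <= 0.
Proof.
move=> dy le y0.
pose z (s : R) := expR (- C * s) * y s.
have dexp (s : R) : is_derive s 1 (fun s => expR (- C * s)) (expR (- C * s) * - C).
  apply: (@is_derive1_comp _ expR (fun s => - C * s)).
  rewrite -[X in is_derive _ _ _ X]mulr1.
  exact: (@is_deriveZ _ _ _ id (- C) s 1 1).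
have dz (s : R) : 0 <= s <= 1 ->
    is_derive s 1 z (expR (- C * s) * (y' s - C * y s)).
  move=> hs; apply: (is_derive_eq (is_derive_mul (dexp s) (dy _ hs))); ring.
have sub01 (s : R) : s \in `]0, 1[ -> 0 <= s <= 1.
  by rewrite in_itv /= => /andP[/ltW -> /ltW ->].
have : z 1 <= z 0.
  apply: (@ler0_derive1_nincr _ z 0 1) => //.
  - by move=> s /sub01/dz [].
  - move=> s /sub01 hs; rewrite derive1E; have := dz _ hs => -[_ ->].
    by rewrite pmulr_rle0 ?expR_gt0 // subr_le0 le.
  - apply: derivable_within_continuous => s; rewrite in_itv /= => /dz [].
    by [].
by rewrite /z y0 mulr0 pmulr_rle0 ?expR_gt0.
Qed.

(** * Uniqueness for linear systems along a complex segment *)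

Section ComplexParts.
Variable R : realType.
Local Notation C := (R[i] : numFieldType).
Implicit Types (x y z : R[i]) (k : R).

Lemma ReB x y : Re (x - y) = Re x - Re y. Proof. by case: x; case: y. Qed.
Lemma ImB x y : Im (x - y) = Im x - Im y. Proof. by case: x; case: y. Qed.
Lemma ReZ k x : Re (k%:C * x) = k * Re x.
Proof. by case: x => a b; rewrite /= mul0r subr0. Qed.
Lemma ImZ k x : Im (k%:C * x) = k * Im x.
Proof. by case: x => a b; rewrite /= mul0r addr0. Qed.

Lemma normr_Re z : `|z| = (Re `|z|)%:C.
Proof. by rewrite normc_def. Qed.

Lemma le_Re x y : x <= y -> Re x <= Re y.
Proof. by rewrite lecE => /andP[]. Qed.

Lemma abs_Re_le z : `|Re z| <= Re `|z|.
Proof. by rewrite normc_def /= -sqrtr_sqr ler_wsqrtr // lerDl sqr_ge0. Qed.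

Lemma abs_Im_le z : `|Im z| <= Re `|z|.
Proof. by rewrite normc_def /= -sqrtr_sqr ler_wsqrtr // lerDr sqr_ge0. Qed.

Lemma norm_le_parts z : `|z| <= (`|Re z| + `|Im z|)%:C.
Proof.
rewrite normc_def lecR -(ger0_norm (addr_ge0 (normr_ge0 _) (normr_ge0 _))).
rewrite -sqrtr_sqr ler_wsqrtr // sqrrD !real_normK ?num_real //.
by rewrite addrAC lerDl mulrn_wge0 // mulr_ge0.
Qed.

Lemma gt0_complex z : 0 < z -> z = (Re z)%:C /\ 0 < Re z.
Proof. by case: z => a b; rewrite ltcE /= => /andP[/eqP -> ->]. Qed.

(** Stated for a real linear [L] so as to apply to the real part and to the
    imaginary part of a holomorphic function. *)
Lemma is_derive_line (L : R[i] -> R) (g : C -> C) (d t0 h : C) (s : R) :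
  (forall x y, L (x - y) = L x - L y) -> (forall k x, L (k%:C * x) = k * L x) ->
  (forall z, `|L z| <= Re `|z|) ->
  is_derive (t0 + s%:C * h : C) 1 g d ->
  is_derive s 1 (fun s => L (g (t0 + s%:C * h))) (L (h * d)).
Proof.
move=> LB LZ Ln /is_derive_eps hg; apply/is_derive_eps => e e0.
pose m := Re `|h|.
have m0 : 0 <= m by apply: le_trans (normr_ge0 _) (abs_Re_le h).
have m1 : 0 < 1 + m by rewrite ltr_wpDr.
have e'0 : 0 < (e / (1 + m))%:C :> R[i] by rewrite ltcR divr_gt0.
have [r r0 hr] := hg _ e'0.
have [rE Rr0] := gt0_complex r0.
exists (Re r / (1 + m)) => [|k]; first by rewrite divr_gt0.
rewrite ltr_pdivlMr // => km.
have nk : `|k%:C * h| = (`|k| * m)%:C.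
  by rewrite normrM (normr_Re h) -/m normc_def /= expr0n addr0 sqrtr_sqr rmorphM.
have : `|k%:C * h| < r.
  rewrite nk rE ltcR; apply: le_lt_trans km.
  by rewrite ler_wpM2l // lerDr.
move=> /hr.
have -> : k%:C * h + (t0 + s%:C * h) = t0 + (k + s)%:C * h.
  by rewrite rmorphD /= mulrDl; ring.
rewrite nk -rmorphM => /le_Re /=.
have -> : L (g (t0 + (k + s)%:C * h)) - L (g (t0 + s%:C * h)) - k * L (h * d) =
    L (g (t0 + (k + s)%:C * h) - g (t0 + s%:C * h) - k%:C * h * d).
  by rewrite !LB -mulrA LZ.
move=> le; apply: le_trans (Ln _) (le_trans le _).
rewrite -mulrA; apply: ler_wpM2l; first exact: ltW.
by rewrite ler_pdivrMl // mulrC ler_wpM2r // lerDr.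
Qed.

Definition sqmod z := Re z ^+ 2 + Im z ^+ 2.

Lemma sqmod_ge0 z : 0 <= sqmod z.
Proof. by rewrite addr_ge0 ?sqr_ge0. Qed.

Lemma sqmodM x y : sqmod (x * y) = sqmod x * sqmod y.
Proof. by case: x => a b; case: y => c d; rewrite /sqmod /=; ring. Qed.

Lemma sqmod_eq0 z : sqmod z <= 0 -> z = 0.
Proof.
case: z => a b; rewrite /sqmod /= => h.
have /eqP := le_anti (introT andP (conj h (addr_ge0 (sqr_ge0 a) (sqr_ge0 b)))).
by rewrite paddr_eq0 ?sqr_ge0 // !sqrf_eq0 => /andP[/eqP -> /eqP ->].
Qed.

Lemma sqmod_sum n (F : 'I_n -> R[i]) :
  sqmod (\sum_j F j) <= 2 ^+ n * \sum_j sqmod (F j).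
Proof.
elim: n F => [|n IH] F; first by rewrite !big_ord0 /sqmod /= !expr0n addr0 mulr0.
rewrite !big_ord_recl.
have sD x y : sqmod (x + y) <= 2 * sqmod x + 2 * sqmod y.
  case: x => a b; case: y => c d; rewrite /sqmod /= -subr_ge0.
  rewrite (_ : _ - _ = (a - c) ^+ 2 + (b - d) ^+ 2); last by ring.
  by rewrite addr_ge0 ?sqr_ge0.
apply: (le_trans (sD _ _)); rewrite [leRHS]mulrDr; apply: lerD.
  by rewrite ler_wpM2r ?sqmod_ge0 // exprS ler_peMr // exprn_ege1 // ler1n.
by rewrite exprS -mulrA ler_wpM2l.
Qed.

(** The sum of the squared moduli of the unknowns satisfies the differential
    inequality of Gronwall's lemma, as the coefficients are bounded. *)
Lemma linear_ode_unique n (g : 'I_n -> R -> R[i]) (A : 'I_n -> 'I_n -> R -> R[i])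
    (B : R) :
  (forall (k : 'I_n) (s : R), 0 <= s <= 1 ->
    is_derive s 1 (fun s => Re (g k s)) (Re (\sum_j A k j s * g j s)) /\
    is_derive s 1 (fun s => Im (g k s)) (Im (\sum_j A k j s * g j s))) ->
  (forall (k j : 'I_n) (s : R), 0 <= s <= 1 -> sqmod (A k j s) <= B) ->
  (forall k : 'I_n, g k 0 = 0) -> forall k : 'I_n, g k 1 = 0.
Proof.
move=> dg AB g0.
pose y (s : R) := \sum_k sqmod (g k s).
pose g' (k : 'I_n) (s : R) := \sum_j A k j s * g j s.
pose y' (s : R) := \sum_k (Re (g' k s) * Re (g k s) + Re (g k s) * Re (g' k s) +
  (Im (g' k s) * Im (g k s) + Im (g k s) * Im (g' k s))).
have dy (s : R) : 0 <= s <= 1 -> is_derive s 1 y (y' s).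
  move=> hs; rewrite (_ : y = \sum_k (fun s => Re (g k s) * Re (g k s) +
      Im (g k s) * Im (g k s))); last first.
    by apply/funext => u; rewrite /y fct_sumE; apply: eq_bigr => k _; rewrite /sqmod !expr2.
  apply: is_derive_sum => k; have [hr hi] := dg k s hs.
  exact: (is_deriveD (is_derive_mul hr hr) (is_derive_mul hi hi)).
have y1 : y 1 <= 0.
  apply: (gronwall_zero (y' := y') (C := 1 + n%:R * (2 ^+ n * B))) => //; last first.
    rewrite /y big1 // => k _.
    by rewrite g0 /sqmod /= expr0n addr0.
  move=> s hs; have amgm z w : Re z * Re w + Re w * Re z +
     (Im z * Im w + Im w * Im z) <= sqmod w + sqmod z.
    case: z => a b; case: w => c d; rewrite /sqmod /= -subr_ge0.
    rewrite (_ : _ - _ = (a - c) ^+ 2 + (b - d) ^+ 2); last by ring.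
    by rewrite addr_ge0 ?sqr_ge0.
  apply: (@le_trans _ _ (\sum_k (sqmod (g k s) + sqmod (g' k s)))).
    by apply: ler_sum => k _; apply: amgm.
  rewrite big_split mulrDl mul1r lerD2l.
  have -> : n%:R * (2 ^+ n * B) * y s = \sum_(k < n) 2 ^+ n * (B * y s).
    by rewrite sumr_const card_ord -mulr_natl; ring.
  apply: ler_sum => k _; apply: (le_trans (sqmod_sum _)).
  rewrite ler_wpM2l // ?exprn_ge0 // mulr_sumr; apply: ler_sum => j _.
  by rewrite sqmodM ler_wpM2r ?sqmod_ge0 // AB.
move=> k; apply: sqmod_eq0; apply: le_trans y1.
rewrite /y (bigD1 k) //= lerDl; apply: sumr_ge0 => j _; exact: sqmod_ge0.
Qed.

End ComplexParts.

(** * The orbit ideal is constant along the orbits *)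

Section AlongPlaques.
Variables (R : realType).
Local Notation C := (R[i] : numFieldType).
Variable xi : 2.-tuple (mpoly 2 C).

Lemma ball_segment (c r t0 t1 : C) (s : R) : 0 <= s <= 1 ->
  ball c r t0 -> ball c r t1 -> ball c r (t0 + s%:C * (t1 - t0)).
Proof.
move=> /andP[s0 s1]; rewrite /ball /= => h0 h1.
have -> : c - (t0 + s%:C * (t1 - t0)) = (1 - s)%:C * (c - t0) + s%:C * (c - t1).
  by rewrite rmorphB rmorph1; ring.
have s0' : 0 <= s%:C :> C by rewrite ler0c.
have s1' : 0 <= (1 - s)%:C :> C by rewrite ler0c subr_ge0.
apply: le_lt_trans (ler_normD _ _) _; rewrite !normrM (ger0_norm s0') (ger0_norm s1').
have -> : r = (1 - s)%:C * r + s%:C * r by rewrite rmorphB rmorph1; ring.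
move: s0; rewrite le_eqVlt => /predU1P[<-|sgt].
  by rewrite subr0 rmorph0 rmorph1 !mul0r !addr0 !mul1r.
apply: ler_ltD; first by apply: ler_wpM2l => //; apply: ltW.
by rewrite ltr_pM2l // ltcR.
Qed.

Lemma derivable_bounded (phi : R -> R) :
  (forall s : R, 0 <= s <= 1 -> exists d, is_derive s 1 phi d) ->
  exists B, forall s, 0 <= s <= 1 -> phi s <= B.
Proof.
move=> dphi; have [|c _ hc] := @EVT_max _ phi 0 1 ler01.
  apply: derivable_within_continuous => s; rewrite in_itv /= => /dphi[d [+ _]].
  by [].
by exists (phi c) => s hs; apply: hc; rewrite in_itv.
Qed.

(** Along the segment from [t0] to [t1] the Lie derivatives of [f] satisfy a
    linear system with bounded coefficients, and they vanish at [t0]. *)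
Lemma orbit_ideal_plaque (c r : C) (gamma : C -> 'rV[C]_2) f (t0 t1 : C) :
  integral_curve xi (ball c r) gamma -> ball c r t0 -> ball c r t1 ->
  orbit_ideal xi (gamma t0) f -> orbit_ideal xi (gamma t1) f.
Proof.
move=> hg b0 b1; suff eval0 h : orbit_ideal xi (gamma t0) h ->
    pt_eval h (gamma t1) = 0.
  move=> hf k; apply: eval0 => j; have := hf (j + k)%N.
  by rewrite iterD.
move=> {f} hf; have [N hN] := lie_jets_finite xi (fun _ : 'I_1 => h).
have {hN} /boolp.choice[a ha] k : exists a : nat -> mpoly 2 C,
    iter k (lie xi) h = \sum_(i < N) a i * iter i (lie xi) h.
  have [a ha] := hN k; exists a; have /rowP/(_ 0) := ha.
  by rewrite mxE summxE => ->; apply: eq_bigr => i _; rewrite !mxE.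
(* [sg] parametrizes the segment, [A] is the matrix of the system. *)
pose l := t1 - t0; pose sg (s : R) : C := t0 + s%:C * l.
pose ev (f : mpoly 2 C) (t : C) : C := pt_eval f (gamma t).
have dline (f : mpoly 2 C) (s : R) : 0 <= s <= 1 ->
    is_derive s 1 (fun s : R => Re (ev f (sg s))) (Re (l * ev (lie xi f) (sg s))) /\
    is_derive s 1 (fun s : R => Im (ev f (sg s))) (Im (l * ev (lie xi f) (sg s))).
  move=> hs; have d := is_derive_along_curve f hg (ball_segment hs b0 b1).
  split; apply: is_derive_line d.
  - exact: ReB.
  - exact: ReZ.
  - exact: abs_Re_le.
  - exact: ImB.
  - exact: ImZ.
  - exact: abs_Im_le.
pose A (k j : 'I_N) (s : R) : C := l * ev (a k.+1 j) (sg s).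
have /boolp.choice[B hB] (kj : 'I_N * 'I_N) : exists B, forall s, 0 <= s <= 1 ->
    sqmod (A kj.1 kj.2 s) <= B.
  have [|B hB] := @derivable_bounded (fun s => sqmod (ev (a kj.1.+1 kj.2) (sg s))).
    move=> s hs; have [dr di] := dline (a kj.1.+1 kj.2) s hs.
    have := is_deriveD (is_derive_mul dr dr) (is_derive_mul di di).
    set d := (X in is_derive _ _ _ X -> _) => h'; exists d.
    rewrite (_ : (fun s => _) = ((fun s => Re (ev (a kj.1.+1 kj.2) (sg s)) *
       Re (ev (a kj.1.+1 kj.2) (sg s))) + (fun s => Im (ev (a kj.1.+1 kj.2) (sg s)) *
       Im (ev (a kj.1.+1 kj.2) (sg s)))) :> (R -> R)) //.
  exists (sqmod l * B) => s hs; rewrite sqmodM.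
  by rewrite ler_wpM2l ?sqmod_ge0 // hB.
pose g (k : 'I_N) (s : R) : C := ev (iter k (lie xi) h) (sg s).
have sg0 : sg 0 = t0 by rewrite /sg mul0r addr0.
have sg1 : sg 1 = t1 by rewrite /sg rmorph1 mul1r addrC subrK.
have g1 : forall k, g k 1 = 0.
  apply: (@linear_ode_unique R N g A (\sum_kj B kj)) => [k s hs|k j s hs|k].
  - suff -> : \sum_j A k j s * g j s = l * ev (lie xi (iter k (lie xi) h)) (sg s).
      exact: dline.
    rewrite -iterS ha /ev [pt_eval _ _]rmorph_sum mulr_sumr.
    by apply: eq_bigr => j _; rewrite -mulrA; congr (_ * _); rewrite [RHS]mevalM.
  - apply: (le_trans (hB (k, j) s hs)); rewrite (bigD1 (k, j)) //= lerDl.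
    apply: sumr_ge0 => kj _; apply: le_trans (hB kj s hs); exact: sqmod_ge0.
  - by rewrite /g sg0; apply: hf.
rewrite -[h]/(iter 0 (lie xi) h) ha [pt_eval _ _]rmorph_sum big1 // => i _.
have := g1 i; rewrite /g sg1 /ev => e.
by rewrite /= mevalM [X in _ * X]e mulr0.
Qed.

Lemma orbit_ideal_same_plaque p q f :
  same_plaque xi p q -> orbit_ideal xi p f <-> orbit_ideal xi q f.
Proof.
move=> [c [r [gamma [hg _ [t0 b0 <-] [t1 b1 <-]]]]].
by split; apply: orbit_ideal_plaque hg _ _.
Qed.

Lemma orbit_ideal_orbit p q f :
  foliation_orbit xi p q -> orbit_ideal xi p f -> orbit_ideal xi q f.
Proof.
move=> [[_ ->]//|[_ pq]].
suff : orbit_ideal xi p f <-> orbit_ideal xi q f by move=> ->.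
elim: pq => [x y /orbit_ideal_same_plaque|x|x y _ [h1 h2]|x y z _ [h1 h2] _ [h3 h4]].
- exact.
- by [].
- by split.
- by split=> [/h1/h3|/h4/h2].
Qed.

End AlongPlaques.

(** * Growth of the iterated Lie derivatives *)

Section JetGrowth.
Variables (K : numFieldType) (n : nat) (xi : n.-tuple (mpoly n K)).
Variable p : 'rV[K]_n.

(** Bounds [s] for the degree and [w] for the sum of the absolute values of the
    coefficients, certified by a presentation of [f] as a sum of monomials; the
    estimates for sums, products and derivatives are then inductions. *)
Inductive size_le : mpoly n K -> nat -> K -> Prop :=
| size_le0 s w : 0 <= w -> size_le 0 s w
| size_leS c m f s w w' : (mdeg m <= s)%N -> size_le f s w -> `|c| + w <= w' ->
    size_le (c *: 'X_[m] + f) s w'.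

Lemma size_le_ge0 f s w : size_le f s w -> 0 <= w.
Proof.
elim=> // c m g s' w1 w' _ _ w1_ge0; apply: le_trans.
by rewrite addr_ge0.
Qed.

Lemma size_leW f s s' w w' : (s <= s')%N -> w <= w' ->
  size_le f s w -> size_le f s' w'.
Proof.
move=> ss' + h; elim: h s' ss' w' => [s1 w1 h|c m g s1 w1 w2 ms _ IH le] s' ss' w' ww'.
  by apply: size_le0; apply: le_trans ww'.
apply: size_leS; [exact: leq_trans ss'|exact: IH|].
exact: le_trans ww'.
Qed.

Lemma size_leD f g s w w' : size_le f s w -> size_le g s w' ->
  size_le (f + g) s (w + w').
Proof.
move=> h; elim: h g w' => [s1 w1 h|c m f' s1 w1 w2 ms _ IH le] g w' hg.
  by rewrite add0r; apply: size_leW hg => //; rewrite lerDr.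
rewrite -addrA; apply: size_leS ms (IH _ _ hg) _.
by rewrite addrA lerD2r.
Qed.

Lemma size_le_sum (J : finType) (F : J -> mpoly n K) s (w : J -> K) :
  (forall j, size_le (F j) s (w j)) -> size_le (\sum_j F j) s (\sum_j w j).
Proof.
move=> h; elim/big_rec2: _ => [|j x y _ hx]; first exact: size_le0.
exact: size_leD.
Qed.

Lemma size_le_mono c m s : (mdeg m <= s)%N -> size_le (c *: 'X_[m]) s `|c|.
Proof.
move=> ms; rewrite -[_ *: _]addr0; apply: size_leS ms (size_le0 s (lexx 0)) _.
by rewrite addr0.
Qed.

Lemma size_leM f g s s' w w' : size_le f s w -> size_le g s' w' ->
  size_le (f * g) (s + s') (w * w').
Proof.
move=> h hg; have w'0 := size_le_ge0 hg.
elim: h => [s1 w1 h|c m f' s1 w1 w2 ms _ IH le].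
  by rewrite mul0r; apply: size_le0; rewrite mulr_ge0.
apply: (@size_leW _ (s1 + s') _ (`|c| * w' + w1 * w')) => //.
  by rewrite -mulrDl ler_wpM2r.
rewrite mulrDl; apply: size_leD => //.
elim: hg w'0 => [s2 w3 h|c' m' g' s2 w3 w4 ms' hg' IH' le'] w'0.
  by rewrite mulr0; apply: size_le0; rewrite mulr_ge0.
have w30 := size_le_ge0 hg'.
apply: (@size_leW _ (s1 + s2) _ (`|c * c'| + `|c| * w3)) => //.
  by rewrite normrM -mulrDr ler_wpM2l.
rewrite mulrDr; apply: size_leD; last exact: IH'.
rewrite -scalerAl -scalerAr scalerA -mpolyXD; apply: size_le_mono.
by rewrite mdegD leq_add.
Qed.

Lemma size_le_mderiv i f s w : size_le f s w ->
  size_le (mderiv i f) s (s%:R * w).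
Proof.
elim=> [s1 w1 h|c m f' s1 w1 w2 ms hf IH le].
  by rewrite mderiv0; apply: size_le0; rewrite mulr_ge0.
apply: (@size_leW _ s1 _ (`|c * (m i)%:R| + s1%:R * w1)) => //.
  apply: le_trans (ler_wpM2l (ler0n _ s1) le).
  rewrite mulrDr lerD2r normrM normr_nat mulrC ler_wpM2r // ler_nat.
  by apply: leq_trans ms; rewrite mdegE (bigD1 i) //= leq_addr.
rewrite mderivD mderivZ mderivX scalerA; apply: size_leD => //.
apply: size_le_mono; apply: leq_trans ms; exact: mdegB.
Qed.

Lemma size_le_exists f : exists s w, size_le f s w.
Proof.
elim/mpolyind: f => [|c m f _ _ [s [w h]]]; first by exists 0%N, 0; apply: size_le0.
exists (maxn (mdeg m) s), (`|c| + w); apply: (@size_leS _ _ _ _ w) => //.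
  exact: leq_maxl.
by apply: size_leW h => //; apply: leq_maxr.
Qed.

(* A number at least [1] that bounds the coordinates of [p]. *)
Let B : K := 1 + \sum_i `|p ord0 i|.

Let B1 : 1 <= B.
Proof. by rewrite lerDl sumr_ge0. Qed.

Let pB i : `|p ord0 i| <= B.
Proof. by rewrite /B (bigD1 i) //= addrCA lerDl addr_ge0 // sumr_ge0. Qed.

Lemma size_le_eval f s w : size_le f s w -> `|pt_eval f p| <= w * B ^+ s.
Proof.
elim=> [s1 w1 h|c m f' s1 w1 w2 ms hf IH le].
  by rewrite [pt_eval _ _]meval0 normr0 mulr_ge0 // exprn_ge0 // (le_trans ler01).
apply: (@le_trans _ _ ((`|c| + w1) * B ^+ s1)); last first.
  by rewrite ler_wpM2r // exprn_ge0 // (le_trans ler01).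
rewrite mulrDl [pt_eval _ _]mevalD; apply: le_trans (ler_normD _ _) _.
apply: lerD => //; rewrite mevalZ mevalX normrM ler_wpM2l //.
apply: (@le_trans _ _ (B ^+ mdeg m)); last by rewrite ler_weXn2l.
rewrite mdegE normr_prod -prodrXr; apply: ler_prod => i _.
rewrite normr_ge0 normrX /=; apply: lerXn2r; rewrite ?nnegrE //.
exact: le_trans B1.
Qed.

(** One Lie derivative raises the degree by a constant [d] and multiplies the sum
    of the absolute values of the coefficients by a constant times the degree.
    The product of the degrees [s + j * d] is at most [k! (s + d)^k]. *)
Lemma jet_growth f : exists C rho, [/\ 0 <= C, 0 <= rho &
  forall k, `|pt_eval (iter k (lie xi) f) p| <= C * k`!%:R * rho ^+ k].
Proof.
have /boolp.choice[sw hsw] (i : 'I_n) : exists x : nat * K,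
    size_le (tnth xi i) x.1 x.2.
  by have [s [w h]] := size_le_exists (tnth xi i); exists (s, w).
pose d := (\max_i (sw i).1)%N; pose S := \sum_i (sw i).2.
have S0 : 0 <= S by apply: sumr_ge0 => i _; apply: size_le_ge0 (hsw i).
have B0 : 0 <= B by apply: le_trans B1.
have hlie g s w : size_le g s w -> size_le (lie xi g) (s + d) (s%:R * S * w).
  move=> hg; have -> : s%:R * S * w = \sum_i (sw i).2 * (s%:R * w).
    by rewrite -mulr_suml /S; ring.
  apply: size_le_sum => i; rewrite addnC; apply: size_leM.
    by apply: size_leW (hsw i) => //; apply: (leq_bigmax (F := fun i => (sw i).1)).
  exact: size_le_mderiv.
have [s [w hf]] := size_le_exists f.
have w0 := size_le_ge0 hf.
have hit k : size_le (iter k (lie xi) f) (s + k * d)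
    (w * k`!%:R * ((s + d)%:R * S) ^+ k).
  elim: k => [|k IH]; first by rewrite mul0n addn0 fact0 expr0 !mulr1.
  rewrite iterS; apply: size_leW (hlie _ _ _ IH); first by rewrite mulSn; lia.
  rewrite factS exprS natrM.
  have -> : w * (k.+1%:R * k`!%:R) * ((s + d)%:R * S * ((s + d)%:R * S) ^+ k) =
    (k.+1 * (s + d))%:R * (S * (w * k`!%:R * ((s + d)%:R * S) ^+ k)).
    by rewrite natrM; ring.
  rewrite -mulrA ler_wpM2r //; last by rewrite ler_nat; nia.
  by rewrite !mulr_ge0 ?exprn_ge0 ?mulr_ge0.
exists (w * B ^+ s), ((s + d)%:R * S * B ^+ d); split.
- by rewrite mulr_ge0 ?exprn_ge0.
- by rewrite !mulr_ge0 ?exprn_ge0.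
move=> k; apply: (le_trans (size_le_eval (hit k))).
rewrite exprD mulnC exprM [X in _ <= _ * X]exprMn.
rewrite le_eqVlt; apply/orP; left; apply/eqP; ring.
Qed.

End JetGrowth.

(** * Taylor series along the field *)

Section TaylorSeries.
Variables (K : numFieldType) (n : nat) (xi : n.-tuple (mpoly n K)).
Variable p : 'rV[K]_n.

Definition taylor_coef f k : K := pt_eval (iter k (lie xi) f) p / k`!%:R.
Definition taylor_sum f m t : K := \sum_(k < m) taylor_coef f k * t ^+ k.

Let fact_neq0 k : k`!%:R != 0 :> K.
Proof. by rewrite pnatr_eq0 -lt0n fact_gt0. Qed.

Lemma taylor_coefD f g k :
  taylor_coef (f + g) k = taylor_coef f k + taylor_coef g k.
Proof.
by rewrite /taylor_coef (iter_derivD (@lieD _ _ xi)) [pt_eval _ _]mevalD mulrDl.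
Qed.

Lemma taylor_coefM f g k : taylor_coef (f * g) k =
  \sum_(i < k.+1) taylor_coef f i * taylor_coef g (k - i).
Proof.
rewrite /taylor_coef (leibniz (@lieD _ _ xi) (@lieM _ _ xi)).
rewrite [pt_eval _ _]rmorph_sum mulr_suml; apply: eq_bigr => i _.
have ik : (i <= k)%N by rewrite -ltnS.
rewrite rmorphMn rmorphM -!/(pt_eval _ _) -[_ *+ _]mulr_natr -(bin_fact ik) !natrM.
have := fact_neq0 i; have := fact_neq0 (k - i); have : ('C(k, i))%:R != 0 :> K.
  by rewrite pnatr_eq0 -lt0n bin_gt0.
by move=> h1 h2 h3; field; rewrite h1 h2 h3.
Qed.

Lemma taylor_coef_lie f k : taylor_coef (lie xi f) k = k.+1%:R * taylor_coef f k.+1.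
Proof.
rewrite /taylor_coef -iterSr factS natrM.
have k1 : k.+1%:R != 0 :> K by rewrite pnatr_eq0.
by have := fact_neq0 k => fk; field; rewrite fk addrC natr1 k1.
Qed.

Lemma taylor_coefC c k : taylor_coef c%:MP k = (k == 0)%:R * c.
Proof.
case: k => [|k]; first by rewrite /taylor_coef [pt_eval _ _]mevalC fact0 divr1 mul1r.
rewrite /taylor_coef iterSr lieC (iter_deriv0 (@lieD _ _ xi)).
by rewrite [pt_eval _ _]meval0 !mul0r.
Qed.

(** Discs are given by their inverse radius [rho], so that the intersection of two
    discs contains the disc given by the sum of the inverse radii.  The ratio
    1/8 leaves room for the factors [k ^ 2] and [k + 1] that appear below, which
    are at most [4 ^ k] and [2 ^ k]. *)
Lemma taylor_coef_geometric f : exists C rho, [/\ 0 <= C, 0 < rho &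
  forall k t, `|t| * rho <= 1 -> `|taylor_coef f k * t ^+ k| <= C * 8^-1 ^+ k].
Proof.
have [C [rho [C0 rho0 h]]] := jet_growth xi p f.
exists C, (8 * rho + 1); split=> //; first by rewrite ltr_wpDl // mulr_ge0.
move=> k t ht; rewrite normrM normrX /taylor_coef normrM normfV normr_nat.
apply: (@le_trans _ _ (C * rho ^+ k * `|t| ^+ k)).
  rewrite ler_wpM2r ?exprn_ge0 // ler_pdivrMr ?ltr0n ?fact_gt0 //.
  by rewrite mulrAC h.
rewrite -mulrA -exprMn ler_wpM2l // lerXn2r ?nnegrE ?mulr_ge0 ?invr_ge0 //.
rewrite -[leRHS]mul1r ler_pdivlMr //.
rewrite (_ : rho * `|t| * 8 = `|t| * (8 * rho)); last by ring.
by apply: le_trans ht; rewrite ler_wpM2l // lerDl.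
Qed.

Lemma taylor_sumD f g m t :
  taylor_sum (f + g) m t = taylor_sum f m t + taylor_sum g m t.
Proof.
rewrite -big_split; apply: eq_bigr => k _.
by rewrite taylor_coefD mulrDl.
Qed.

Let halfE k : (2^-1 : K) ^+ k = (2 ^+ k)^-1. Proof. by rewrite exprVn. Qed.

(** The partial sums are values of the truncated polynomials [F] and [G], and the
    coefficients of [F * G] of degree less than [m] are those of the series of
    [f * g]; the other ones are geometrically small. *)
Lemma taylor_sumM f g C C' rho rho' : 0 <= C -> 0 <= C' ->
  (forall k t, `|t| * rho <= 1 -> `|taylor_coef f k * t ^+ k| <= C * 8^-1 ^+ k) ->
  (forall k t, `|t| * rho' <= 1 -> `|taylor_coef g k * t ^+ k| <= C' * 8^-1 ^+ k) ->
  forall m t, `|t| * rho <= 1 -> `|t| * rho' <= 1 ->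
  `|taylor_sum f m t * taylor_sum g m t - taylor_sum (f * g) m t| <=
    C * C' * 2^-1 ^+ m.
Proof.
move=> C0 C'0 hf hg m t ht ht'.
pose F := \poly_(k < m) taylor_coef f k; pose G := \poly_(k < m) taylor_coef g k.
have eF : taylor_sum f m t = F.[t] by rewrite horner_poly.
have eG : taylor_sum g m t = G.[t] by rewrite horner_poly.
rewrite eF eG -hornerM (@horner_coef_wide _ (m + m)); last first.
  apply: leq_trans (size_polyMleq _ _) _; apply: leq_trans (leq_pred _) _.
  by apply: leq_add; apply: size_poly.
rewrite big_split_ord /=.
have -> : \sum_(i < m) (F * G)`_i * t ^+ i = taylor_sum (f * g) m t.
  apply: eq_bigr => k _; congr (_ * _); rewrite taylor_coefM coefM.
  apply: eq_bigr => i _; rewrite !coef_poly.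
  have -> : (i < m)%N by have := ltn_ord i; have := ltn_ord k; lia.
  by have -> : (k - i < m)%N by have := ltn_ord k; lia.
rewrite addrAC subrr add0r; apply: le_trans (ler_norm_sum _ _ _) _.
apply: (@le_trans _ _ (\sum_(k < m) C * C' * 4^-1 ^+ m)); last first.
  rewrite sumr_const card_ord -[_ *+ m]mulr_natl mulrCA ler_wpM2l ?mulr_ge0 //.
  have -> : (4 : K) = 2 * 2 by rewrite -natrM.
  rewrite invfM exprMn mulrA ler_piMl ?exprn_ge0 ?invr_ge0 //.
  rewrite halfE ler_pdivrMr ?exprn_gt0 // mul1r -natrX ler_nat ltnW //.
  exact: ltn_expl.
apply: ler_sum => k _; set l := (m + k)%N.
apply: (@le_trans _ _ (\sum_(i < l.+1) C * C' * 8^-1 ^+ l)).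
  rewrite coefM mulr_suml; apply: le_trans (ler_norm_sum _ _ _) _.
  apply: ler_sum => i _; have il : (i <= l)%N by rewrite -ltnS.
  have expl (x : K) : x ^+ l = x ^+ i * x ^+ (l - i) by rewrite -exprD subnKC.
  have -> : F`_i * G`_(l - i) * t ^+ l = (F`_i * t ^+ i) * (G`_(l - i) * t ^+ (l - i)).
    by rewrite expl; ring.
  rewrite normrM expl.
  have -> : C * C' * (8^-1 ^+ i * 8^-1 ^+ (l - i)) =
      C * 8^-1 ^+ i * (C' * 8^-1 ^+ (l - i)) by ring.
  apply: ler_pM => //; rewrite coef_poly; case: ifP => _; rewrite ?hf ?hg //.
    by rewrite mul0r normr0 mulr_ge0 // exprn_ge0 // invr_ge0.
  by rewrite mul0r normr0 mulr_ge0 // exprn_ge0 // invr_ge0.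
rewrite sumr_const card_ord -[_ *+ l.+1]mulr_natl mulrCA ler_wpM2l ?mulr_ge0 //.
have -> : (8 : K) = 2 * 4 by rewrite -natrM.
rewrite invfM exprMn mulrA.
apply: (@le_trans _ _ (4^-1 ^+ l)).
  rewrite ler_piMl ?exprn_ge0 ?invr_ge0 //.
  rewrite halfE ler_pdivrMr ?exprn_gt0 // mul1r -natrX ler_nat.
  exact: ltn_expl.
rewrite /l exprD ler_piMr ?exprn_ge0 ?invr_ge0 // exprn_ile1 ?invr_ge0 //.
by rewrite invf_le1 // ler1n.
Qed.

(** With [D_k] for the increment on the left, [D_{k+1}] is
    [(t + h) * D_k + k * h ^+ 2 * t ^+ (k - 1)].  The factor [r ^+ 2] keeps the
    exponent of [r] on the right nonnegative for small [k]. *)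
Lemma power_increment (t h r : K) k : `|t| <= r -> `|t + h| <= r ->
  r ^+ 2 * `|(t + h) ^+ k - t ^+ k - k%:R * h * t ^+ k.-1| <=
    (k ^ 2)%:R * `|h| ^+ 2 * r ^+ k.
Proof.
move=> tr thr; have r0 : 0 <= r by apply: le_trans tr.
elim: k => [|k IH].
  by rewrite !expr0 subrr mul0r mul0r subrr normr0 mulr0 exp0n // !mul0r.
set D := (X in `|X|) in IH.
have -> : (t + h) ^+ k.+1 - t ^+ k.+1 - k.+1%:R * h * t ^+ k.+1.-1 =
    (t + h) * D + k%:R * h ^+ 2 * t ^+ k.-1.
  rewrite /D -(natr1 k) !exprS /=; case: k {IH D} => [|k] /=; first by rewrite !mul0r; ring.
  by rewrite !exprS; ring.
apply: (@le_trans _ _ (r ^+ 2 * (r * `|D| + k%:R * `|h| ^+ 2 * r ^+ k.-1))).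
  rewrite ler_wpM2l ?exprn_ge0 //; apply: le_trans (ler_normD _ _) _.
  apply: lerD; first by rewrite normrM ler_wpM2r.
  rewrite !normrM normr_nat !normrX ler_wpM2l ?mulr_ge0 ?exprn_ge0 //.
  by rewrite lerXn2r ?nnegrE.
apply: (@le_trans _ _ (r * ((k ^ 2)%:R * `|h| ^+ 2 * r ^+ k) +
    k%:R * `|h| ^+ 2 * r ^+ k.+1)).
  rewrite mulrDr; apply: lerD; first by rewrite mulrCA ler_wpM2l.
  case: (k) => [|k']; first by rewrite !mul0r mulr0.
  by rewrite mulrCA -exprD.
have -> : r * ((k ^ 2)%:R * `|h| ^+ 2 * r ^+ k) + k%:R * `|h| ^+ 2 * r ^+ k.+1 =
    (k ^ 2 + k)%:R * `|h| ^+ 2 * r ^+ k.+1 by rewrite natrD [r ^+ k.+1]exprS; ring.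
rewrite -!mulrA ler_wpM2r ?mulr_ge0 ?exprn_ge0 // ler_nat; nia.
Qed.

(** Term by term differentiation with a quadratic error, uniform in the number of
    terms: the derivative of the series of [f] is the series of [lie xi f]. *)
Lemma taylor_sum_increment f C rho m t h : 0 <= C -> 0 < rho ->
  (forall k t, `|t| * rho <= 1 -> `|taylor_coef f k * t ^+ k| <= C * 8^-1 ^+ k) ->
  `|t| <= rho^-1 -> `|t + h| <= rho^-1 ->
  `|taylor_sum f m.+1 (t + h) - taylor_sum f m.+1 t -
    h * taylor_sum (lie xi f) m t| <= 2 * C * rho ^+ 2 * `|h| ^+ 2.
Proof.
move=> C0 rho0 hf ht hth; set r := rho^-1.
have r0 : 0 < r by rewrite invr_gt0.
pose D k := (t + h) ^+ k - t ^+ k - k%:R * h * t ^+ k.-1.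
have -> : taylor_sum f m.+1 (t + h) - taylor_sum f m.+1 t -
    h * taylor_sum (lie xi f) m t = \sum_(k < m.+1) taylor_coef f k * D k.
  have -> : h * taylor_sum (lie xi f) m t =
      \sum_(k < m.+1) taylor_coef f k * (k%:R * h * t ^+ k.-1).
    rewrite big_ord_recl /= !mul0r mulr0 add0r mulr_sumr; apply: eq_bigr => k _.
    by rewrite taylor_coef_lie /bump /= !add1n !add0n /=; ring.
  rewrite -!sumrB; apply: eq_bigr => k _; rewrite /D; ring.
have r2 : 0 < r ^+ 2 by rewrite exprn_gt0.
rewrite -(ler_pM2l r2).
have -> : r ^+ 2 * (2 * C * rho ^+ 2 * `|h| ^+ 2) = 2 * C * `|h| ^+ 2.
  by rewrite /r; field; rewrite gt_eqF.
apply: (@le_trans _ _ (\sum_(k < m.+1) C * `|h| ^+ 2 * 2^-1 ^+ k)).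
  rewrite -[X in X * _]gtr0_norm // -normrM mulr_sumr.
  apply: le_trans (ler_norm_sum _ _ _) _; apply: ler_sum => k _.
  rewrite mulrCA normrM [`|r ^+ 2 * _|]normrM (gtr0_norm r2).
  apply: (@le_trans _ _ (`|taylor_coef f k| * ((k ^ 2)%:R * `|h| ^+ 2 * r ^+ k))).
    by rewrite ler_wpM2l // power_increment.
  have := hf k r; rewrite (gtr0_norm r0) mulVf ?gt_eqF // => /(_ (lexx 1)).
  rewrite normrM normrX (gtr0_norm r0) => le.
  rewrite mulrCA mulrA -mulrA; apply: (@le_trans _ _
    (((k ^ 2)%:R * `|h| ^+ 2) * (C * 8^-1 ^+ k))); first by rewrite ler_wpM2l // mulr_ge0 // exprn_ge0.
  have -> : (k ^ 2)%:R * `|h| ^+ 2 * (C * 8^-1 ^+ k) =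
    C * `|h| ^+ 2 * ((k ^ 2)%:R * 8^-1 ^+ k) by ring.
  rewrite ler_wpM2l ?mulr_ge0 ?exprn_ge0 //.
  have -> : (8 : K) = 4 * 2 by rewrite -natrM.
  rewrite invfM exprMn mulrA ler_piMl ?exprn_ge0 ?invr_ge0 // exprVn.
  rewrite ler_pdivrMr ?exprn_gt0 // mul1r -natrX ler_nat.
  have -> : (4 = 2 ^ 2)%N by []. 
  by rewrite -expnM mulnC expnM leq_exp2r // ltnW // ltn_expl.
rewrite -mulr_sumr (_ : 2 * C * `|h| ^+ 2 = C * `|h| ^+ 2 * 2); last by ring.
rewrite ler_wpM2l ?mulr_ge0 ?exprn_ge0 //.
suff -> : \sum_(k < m.+1) (2^-1 : K) ^+ k = 2 - 2^-1 ^+ m.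
  by rewrite lerBlDr lerDl exprn_ge0 // invr_ge0.
elim: m {D} => [|m IH]; first by rewrite big_ord1 expr0; ring.
by rewrite big_ord_recr /= IH exprS; field.
Qed.

End TaylorSeries.

(** * Existence of integral curves *)

Section Solution.
Variables (K : numFieldType) (n : nat) (xi : n.-tuple (mpoly n K)).
Variable p : 'rV[K]_n.
Hypothesis half_small : forall e : K, 0 < e ->
  exists N, forall m, (N <= m)%N -> 2^-1 ^+ m <= e.
Hypothesis geometric_complete : forall (u : nat -> K) (C : K),
  (forall m, `|u m.+1 - u m| <= C * 2^-1 ^+ m) -> exists l : K, u @ \oo --> l.

Let tsum := taylor_sum xi p.

Lemma geometric_cvg0 (u : nat -> K) C : 0 <= C ->
  (forall m, `|u m| <= C * 2^-1 ^+ m) -> u @ \oo --> (0 : K).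
Proof.
move=> C0 hu; apply/cvgrPdist_le => e e0.
have C1 : 0 < C + 1 by rewrite ltr_wpDl.
have [N hN] := half_small (divr_gt0 e0 C1).
exists N => // m /= Nm; rewrite sub0r normrN; apply: le_trans (hu m) _.
have := hN m Nm; rewrite ler_pdivlMr // mulrC; apply: le_trans.
by rewrite ler_wpM2r ?exprn_ge0 ?invr_ge0 // lerDl.
Qed.

Let tconv f t l := tsum f m t @[m --> \oo] --> (l : K).

Let flow t : 'rV[K]_n := \row_i lim (tsum 'X_i m t @[m --> \oo]).

Let in_disc (t rho rho' : K) : 0 < rho -> 0 < rho' -> `|t| * (rho + rho') <= 1 ->
  `|t| * rho <= 1 /\ `|t| * rho' <= 1.
Proof.
move=> r0 r0' h; split; apply: le_trans h; rewrite ler_wpM2l //.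
  by rewrite lerDl ltW.
by rewrite lerDr ltW.
Qed.

(** On a small disc the Taylor series of [f] converges to the value of [f] on the
    curve: both sides are ring morphisms in [f] and they agree on the
    coordinates. *)
Let flow_conv f : exists rho, 0 < rho /\
  forall t, `|t| * rho <= 1 -> tconv f t (pt_eval f (flow t)).
Proof.
elim/mpoly_ring_ind: f => [c|i|f g [r [r0 hf]] [r' [r'0 hg]]|f g [r [r0 hf]] [r' [r'0 hg]]].
- exists 1; split=> // t _; rewrite [pt_eval _ _]mevalC /tconv -(cvg_shiftS _ _).
  rewrite (_ : (fun m => _) = fun=> c); first exact: cvg_cst.
  apply/funext => m; rewrite /tsum /taylor_sum big_ord_recl taylor_coefC.
  rewrite big1 ?addr0 => [|k _]; first by rewrite eqxx mul1r expr0 mulr1.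
  by rewrite taylor_coefC mul0r mul0r.
- have [C [rho [C0 rho0 h]]] := taylor_coef_geometric xi p 'X_i.
  exists rho; split=> // t ht; rewrite [pt_eval _ _]mevalXU mxE.
  have [l hl] : exists l : K, tsum 'X_i m t @[m --> \oo] --> (l : K).
    apply: (@geometric_complete _ C) => m.
    rewrite /tsum /taylor_sum big_ord_recr /= addrAC subrr add0r.
    apply: (le_trans (h m t ht)); rewrite ler_wpM2l // lerXn2r ?nnegrE ?invr_ge0 //.
    by rewrite lef_pV2 ?posrE // ler_nat.
  by rewrite /tconv (cvg_lim _ hl).
- exists (r + r'); split=> [|t /(in_disc r0 r'0)[ht ht']]; first exact: addr_gt0.
  rewrite /tconv [pt_eval _ _]mevalD.
  rewrite (_ : (fun m => _) = (fun m => tsum f m t + tsum g m t)); last first.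
    by apply/funext => m; apply: taylor_sumD.
  exact: (cvgD (hf t ht) (hg t ht')).
have [C [a [C0 a0 ha]]] := taylor_coef_geometric xi p f.
have [C' [a' [C'0 a'0 ha']]] := taylor_coef_geometric xi p g.
exists ((r + r') + (a + a')); split=> [|t]; first by rewrite !addr_gt0.
move=> /(in_disc (addr_gt0 r0 r'0) (addr_gt0 a0 a'0))[].
move=> /(in_disc r0 r'0)[ht ht'] /(in_disc a0 a'0)[hta hta'].
rewrite /tconv [pt_eval _ _]mevalM.
rewrite (_ : (fun m => _) = (fun m => tsum f m t * tsum g m t -
   (tsum f m t * tsum g m t - tsum (f * g) m t))); last first.
  by apply/funext => m; rewrite subKr.
rewrite -[X in _ --> X]subr0; apply: cvgB.
  exact: (cvgM (hf t ht) (hg t ht')).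
apply: (@geometric_cvg0 _ (C * C')); first exact: mulr_ge0.
by move=> m; apply: (taylor_sumM (rho := a) (rho' := a')).
Qed.

Let min_pos (a b : K) : 0 < a -> 0 < b -> exists c, [/\ 0 < c, c <= a & c <= b].
Proof.
move=> a0 b0; have ab0 : 0 < a + b by rewrite addr_gt0.
exists (a * b / (a + b)); split; first by rewrite !mulr_gt0 ?invr_gt0.
  by rewrite ler_pdivrMr // ler_wpM2l ?lerDr // ltW.
by rewrite ler_pdivrMr // mulrC ler_wpM2l ?lerDl // ltW.
Qed.

(** The limit of the second order estimate of the partial sums; the arbitrary
    [eta] absorbs the distance to the limit. *)
Let flow_increment i : exists rho M, [/\ 0 < rho, 0 <= M &
  forall t h, `|t| * rho <= 1 -> `|t + h| * rho <= 1 -> forall eta, 0 < eta ->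
  `|flow (t + h) ord0 i - flow t ord0 i - h * pt_eval (tnth xi i) (flow t)| <=
    M * `|h| ^+ 2 + eta * (2 + `|h|)].
Proof.
have [C [a [C0 a0 ha]]] := taylor_coef_geometric xi p 'X_i.
have [r [r0 hr]] := flow_conv 'X_i.
have [r' [r'0 hr']] := flow_conv (tnth xi i).
exists (a + (r + r')), (2 * C * a ^+ 2); split=> [||t h].
- by rewrite !addr_gt0.
- by rewrite !mulr_ge0 ?exprn_ge0 // ltW.
move=> /(in_disc a0 (addr_gt0 r0 r'0))[ta /(in_disc r0 r'0)[tr tr']].
move=> /(in_disc a0 (addr_gt0 r0 r'0))[tha /(in_disc r0 r'0)[thr _]] eta eta0.
have inva (x : K) : `|x| * a <= 1 -> `|x| <= a^-1.
  by move=> h'; rewrite -[leRHS]mul1r ler_pdivlMr.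
have ev (f : mpoly n K) x : tconv f x (pt_eval f (flow x)) ->
    exists N, forall m, (N <= m)%N -> `|pt_eval f (flow x) - tsum f m x| <= eta.
  by move=> /cvgrPdist_le/(_ _ eta0)[N _ hN]; exists N => m Nm; apply: hN.
have [N1 h1] := ev _ _ (hr _ thr); have [N2 h2] := ev _ _ (hr _ tr).
have [N3 h3] := ev _ _ (hr' _ tr').
pose m := (N1 + N2 + N3)%N.
have m1 : (N1 <= m.+1)%N by rewrite leqW // /m -addnA leq_addr.
have m2 : (N2 <= m.+1)%N.
  by rewrite leqW //; apply: leq_trans (leq_addl N1 N2) (leq_addr N3 _).
have {}h1 := h1 _ m1; have {}h2 := h2 _ m2; have {}h3 := h3 m (leq_addl _ _).
rewrite [pt_eval _ _]mevalXU in h1; rewrite [pt_eval _ _]mevalXU in h2.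
have h4 := taylor_sum_increment m C0 a0 ha (inva _ ta) (inva _ tha).
rewrite lieX -!/(tsum _ _ _) in h4.
set A := flow (t + h) ord0 i in h1 *; set A2 := flow t ord0 i in h2 *.
set A3 := pt_eval _ _ in h3 *.
have -> : A - A2 - h * A3 =
    (tsum 'X_i m.+1 (t + h) - tsum 'X_i m.+1 t - h * tsum (tnth xi i) m t) +
    ((A - tsum 'X_i m.+1 (t + h)) - (A2 - tsum 'X_i m.+1 t) -
     h * (A3 - tsum (tnth xi i) m t)) by ring.
apply: le_trans (ler_normD _ _) _; apply: lerD => //.
apply: le_trans (ler_normB _ _) _; rewrite [leRHS]mulrDr; apply: lerD.
  apply: le_trans (ler_normB _ _) _.
  by rewrite mulr_natr mulr2n; apply: lerD.
by rewrite normrM mulrC ler_wpM2r.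
Qed.

Let flow0 : flow 0 = p.
Proof.
apply/rowP => i; rewrite mxE; apply: cvg_lim => //.
rewrite -(cvg_shiftS _ _) (_ : (fun m => _) = fun=> p ord0 i); first exact: cvg_cst.
apply/funext => m; rewrite /tsum /taylor_sum big_ord_recl expr0 mulr1.
rewrite big1 ?addr0 => [|k _]; last by rewrite expr0n /= mulr0.
by rewrite /taylor_coef fact0 divr1 [pt_eval _ _]mevalXU.
Qed.

(** Cauchy: the curve whose components are the Taylor series of the coordinate
    functions solves the equation, because these series are multiplicative and
    their derivatives are the Taylor series of the components of the field. *)
Lemma integral_curve_exists : exists r gamma,
  [/\ 0 < r, integral_curve xi (ball 0 r) gamma & gamma 0 = p].
Proof.
have /boolp.choice[rM hrM] i : exists x : K * K, [/\ 0 < x.1, 0 <= x.2 &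
  forall t h, `|t| * x.1 <= 1 -> `|t + h| * x.1 <= 1 -> forall eta, 0 < eta ->
  `|flow (t + h) ord0 i - flow t ord0 i - h * pt_eval (tnth xi i) (flow t)| <=
    x.2 * `|h| ^+ 2 + eta * (2 + `|h|)].
  by have [rho [M h]] := flow_increment i; exists (rho, M).
pose rho := 1 + \sum_i (rM i).1.
have rhoi i : (rM i).1 <= rho.
  rewrite /rho (bigD1 i) //= addrCA lerDl addr_ge0 // sumr_ge0 // => j _.
  by have [/ltW] := hrM j.
have rho0 : 0 < rho.
  by rewrite ltr_wpDr // sumr_ge0 // => j _; have [/ltW] := hrM j.
exists rho^-1, flow; split=> // [|t]; first by rewrite invr_gt0.
rewrite /ball /= sub0r normrN => ht i.
have [ri0 Mi0 hi] := hrM i; set M := (rM i).2 in Mi0 hi.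
have disc (x : K) : `|x| <= rho^-1 -> `|x| * (rM i).1 <= 1.
  rewrite -[rho^-1]mul1r ler_pdivlMr // => h'; apply: le_trans h'.
  by rewrite ler_wpM2l.
apply/is_derive_eps => e e0.
have d1 : 0 < rho^-1 - `|t| by rewrite subr_gt0.
have d2 : 0 < e / 2 / (M + 1) by rewrite !divr_gt0 // ltr_wpDl.
have [d [d0 dd1 dd2]] := min_pos d1 d2.
exists d => // h hd; have [->|h0] := eqVneq h 0.
  by rewrite add0r subrr mul0r subr0 normr0 mulr0.
have hgt : 0 < `|h| by rewrite normr_gt0.
pose eta := e * `|h| / 2 / (2 + `|h|).
have h2gt : 0 < 2 + `|h| by rewrite addr_gt0.
have eta0 : 0 < eta by rewrite /eta !divr_gt0 // mulr_gt0.
have := hi t h (disc _ (ltW ht)) _ _ eta0; rewrite [h + t]addrC.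
move=> /(_ (disc _ _)) le; apply: le_trans (le _) _.
  apply: le_trans (ler_normD _ _) _; rewrite -lerBrDl.
  exact: le_trans (ltW hd) dd1.
rewrite /eta divfK ?gt_eqF //.
rewrite [leRHS](_ : _ = e * `|h| / 2 + e * `|h| / 2); last by field.
rewrite lerD2r expr2 mulrA mulrAC.
have -> : e * `|h| / 2 = e / 2 * `|h| by ring.
rewrite ler_wpM2r //; apply: (@le_trans _ _ ((M + 1) * `|h|)).
  by rewrite ler_wpM2r // lerDl.
rewrite mulrC -ler_pdivlMr ?ltr_wpDl //; exact: le_trans (ltW hd) dd2.
Qed.

End Solution.

(** * Completeness of the complex numbers *)

(** The nested intervals of centre [x m] and radius [2 * c * 2^-1 ^+ m] have a
    common point. *)
Lemma real_geometric_limit (R : realType) (x : nat -> R) (c : R) :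
  (forall m, `|x m.+1 - x m| <= c * 2^-1 ^+ m) ->
  exists l, forall m, `|x m - l| <= 2 * c * 2^-1 ^+ m.
Proof.
move=> hx; have c0 : 0 <= c.
  by have := hx 0%N; rewrite expr0 mulr1; apply: le_trans.
pose lo m := x m - 2 * c * 2^-1 ^+ m; pose hi m := x m + 2 * c * 2^-1 ^+ m.
have lohi m : lo m <= hi m.
  have y0 : 0 <= 2 * c * 2^-1 ^+ m by rewrite !mulr_ge0 // exprn_ge0 // invr_ge0.
  by rewrite lerD2l (le_trans _ y0) // oppr_le0.
have half m : 2 * c * 2^-1 ^+ m = 2 * c * 2^-1 ^+ m.+1 + c * 2^-1 ^+ m.
  by rewrite exprS; field.
have lo_incr : {homo lo : m k / (m <= k)%N >-> m <= k}.
  apply: homo_leq => // [y z w|m]; first exact: le_trans.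
  rewrite /lo; have := half m; have := hx m; rewrite ler_norml => /andP[+ _].
  move: (c * _) (2 * c * 2^-1 ^+ m) (2 * c * 2^-1 ^+ m.+1) => u v w; lra.
have hi_decr : {homo hi : m k / (m <= k)%N >-> k <= m}.
  apply: homo_leq => // [y z w h1 h2|m]; first exact: le_trans h2 h1.
  rewrite /hi; have := half m; have := hx m; rewrite ler_norml => /andP[_].
  move: (c * _) (2 * c * 2^-1 ^+ m) (2 * c * 2^-1 ^+ m.+1) => u v w; lra.
have lo_hi m k : lo m <= hi k.
  apply: (@le_trans _ _ (lo (maxn m k))); first by apply/lo_incr/leq_maxl.
  by apply: (le_trans (lohi _)); apply/hi_decr/leq_maxr.
exists (sup (range lo)) => m.
have ub : ubound (range lo) (hi m) by move=> _ [k _ <-].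
have h1 : lo m <= sup (range lo) by apply: ub_le_sup; [exists (hi m)|exists m].
have h2 : sup (range lo) <= hi m by apply: ge_sup => //; exists (lo 0%N), 0%N.
by move: h1 h2; rewrite /lo /hi ler_norml; lra.
Qed.

Section ComplexAnalysis.
Variable R : realType.
Local Notation C := (R[i] : numFieldType).

Let halfE m : (2^-1 : C) ^+ m = ((2^-1 : R) ^+ m)%:C.
Proof. by rewrite rmorphXn fmorphV rmorph_nat. Qed.

Lemma complex_half_small (e : C) : 0 < e ->
  exists N, forall m, (N <= m)%N -> (2^-1 : C) ^+ m <= e.
Proof.
move=> /gt0_complex[-> e0]; exists (Num.bound (Re e)^-1) => m hm.
rewrite halfE lecR exprVn -[leRHS]invrK lef_pV2 ?posrE ?exprn_gt0 ?invr_gt0 //.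
apply: ltW; apply: (@lt_trans _ _ (Num.bound (Re e)^-1)%:R).
  by apply: archi_boundP; rewrite invr_ge0 ltW.
by rewrite -natrX ltr_nat; apply: leq_ltn_trans hm (ltn_expl _ _).
Qed.

Lemma complex_geometric_complete (u : nat -> C) (c : C) :
  (forall m, `|u m.+1 - u m| <= c * 2^-1 ^+ m) -> exists l : C, u @ \oo --> l.
Proof.
move=> hu.
have cE : c = (Re c)%:C.
  have : 0 <= c by have := hu 0%N; rewrite expr0 mulr1; apply: le_trans.
  by rewrite lecE /= => /andP[/eqP h _]; case: (c) h => a b /= ->.
have hRe m : Re `|u m.+1 - u m| <= Re c * 2^-1 ^+ m.
  by have /le_Re := hu m; rewrite cE halfE -rmorphM.
have [a ha] : exists l, forall m, `|Re (u m) - l| <= 2 * Re c * 2^-1 ^+ m.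
  apply: real_geometric_limit => m; rewrite -ReB.
  exact: le_trans (abs_Re_le _) (hRe m).
have [b hb] : exists l, forall m, `|Im (u m) - l| <= 2 * Re c * 2^-1 ^+ m.
  apply: real_geometric_limit => m; rewrite -ImB.
  exact: le_trans (abs_Im_le _) (hRe m).
exists (a +i* b : C).
have rc0 : 0 <= Re c.
  by have := hRe 0%N; rewrite expr0 mulr1; apply: le_trans; apply: le_trans (normr_ge0 _) (abs_Re_le _).
have lim0 : (u m - (a +i* b : C)) @[m --> \oo] --> (0 : C).
  apply: (geometric_cvg0 complex_half_small (C := (4 * Re c)%:C)) => [|m].
    by rewrite ler0c mulr_ge0.
  apply: le_trans (norm_le_parts _) _; rewrite halfE -rmorphM lecR ReB ImB /=.
  by have := ha m; have := hb m; lra.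
rewrite (_ : u = (fun m => u m - (a +i* b : C) + (a +i* b : C))); last first.
  by apply/funext => m; rewrite subrK.
by rewrite -[X in _ --> X]add0r; apply: cvgD lim0 (cvg_cst _).
Qed.

(** * The Zariski closures of the orbits *)

Variable xi : 2.-tuple (mpoly 2 C).
Implicit Types p q : 'rV[C]_2.

(** Near a regular point the orbit contains the points of an integral curve, and
    the derivatives at [0] of [f] along this curve are the values at [p] of the
    iterated Lie derivatives.  The curve stays away from the singular points:
    at such a point the orbit ideal contains the components of the field, which
    would then vanish along the curve, hence at [p]. *)
Lemma vanishing_on_orbit p f :
  (forall q, foliation_orbit xi p q -> pt_eval f q = 0) <-> orbit_ideal xi p f.
Proof.
split=> [hf|hf q /orbit_ideal_orbit/(_ hf)/orbit_ideal_eval //].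
case: (pselect (Sing xi p)) => [sp|nS].
  by apply: orbit_ideal_Sing => //; apply: hf; left.
have [r [gamma [r0 hg g0]]] :=
  integral_curve_exists xi p complex_half_small complex_geometric_complete.
have b0 : ball (0 : C) r (0 : C) by rewrite /ball /= subrr normr0.
have regular t : ball (0 : C) r t -> ~ Sing xi (gamma t).
  move=> bt sing; apply: nS => i; apply: (@orbit_ideal_eval _ _ xi).
  rewrite -g0; apply: (orbit_ideal_plaque hg bt b0).
  by apply: orbit_ideal_Sing => //; apply: sing.
have orb t : ball (0 : C) r t -> foliation_orbit xi p (gamma t).
  move=> bt; right; split=> //; apply: rst_step; exists 0, r, gamma.
  split; [exact: hg| |by exists 0|by exists t].
  by move=> _ [s bs <-]; apply: regular.
suff h : forall k t, ball (0 : C) r t -> pt_eval (iter k (lie xi) f) (gamma t) = 0.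
  by move=> k; rewrite -g0 h.
elim=> [|k IH] t bt; first exact/hf/orb.
have d1 := is_derive_along_curve (iter k (lie xi) f) hg bt.
have d0 : is_derive t 1 (fun s => pt_eval (iter k (lie xi) f) (gamma s)) (0 : C).
  apply: near_eq_is_derive (is_derive_cst (0 : C) t 1).
  apply/nbhs_ballP; exists (r - `|t|).
    by move: bt; rewrite /ball /= sub0r normrN subr_gt0.
  move=> s; rewrite /ball /= => ts; apply/esym/IH.
  rewrite /ball /= sub0r normrN.
  rewrite (_ : s = t - (t - s)); last by rewrite subKr.
  apply: le_lt_trans (ler_normB _ _) _.
  by rewrite addrC -ltrBrDr.
by rewrite iterS -(derive_val (is_derive := d1)) (derive_val (is_derive := d0)).
Qed.

End ComplexAnalysis.

Theorem theorem8 (R : realType) (P Q : mpoly.mpoly 2 R[i]) :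
  constructible_orbits [tuple P; Q] [set: 'rV[R[i]]_2].
Proof.
rewrite /constructible_orbits.
set xi : 2.-tuple (mpoly 2 R[i]) := [tuple P; Q].
have := constructible_orbit_ideal_relation xi.
congr constructible; apply/seteqP; split=> z /=.
  move=> h; split=> //; apply/zariski_closureP => f hf; apply: h.
  exact/vanishing_on_orbit.
move=> [_ _ /zariski_closureP h] f hf; apply: h; exact/vanishing_on_orbit.
Qed.
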